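(* Let $m>0$ and $k>0$. For any given radius $r_0>0$, density $\rho_0>0$ and velocity $v_0$, there exists a unique smooth steady state solution $\rho=\rho(r)$, $v=v(r)$ of the static Euler model $$\frac{d}{dr}(r^2\rho v)=0,\qquad \frac{d}{dr}\big(r^2(v^2+k^2)\rho\big)-2k^2\rho r+m\rho=0,$$ with initial condition $\rho(r_0)=\rho_0$, $v(r_0)=v_0$, such that the velocity satisfies $\operatorname{sgn}(v)=\operatorname{sgn}(v_0)$ and $\operatorname{sgn}(|v|-k)=\operatorname{sgn}(|v_0|-k)$ on the corresponding domain of definition. Furthermore, there are the following families of solutions: (i) If $G(r_0,v_0)>-\frac32k^2-k^2\ln\frac{m^2}{4k^3}$, then the steady state solution is defined on the whole interval $(0,+\infty)$. (ii) If $G(r_0,v_0)=-\frac32k^2-k^2\ln\frac{m^2}{4k^3}$, then the solution is a critical steady state solution on the whole interval $(0,+\infty)$, whose velocity is one of the functions $v_*^{P,\flat},v_*^{P,\sharp},v_*^{N,\flat},v_*^{N,\sharp}$. (iii) If $G(r_0,v_0)<-\frac32k^2-k^2\ln\frac{m^2}{4k^3}$, then the solution is defined on $(0,\underline r_S)$ if $r_0<\frac{m}{2k^2}$, or on $(\bar r_S,+\infty)$ if $r_0>\frac{m}{2k^2}$, where $\underline r_S<\frac{m}{2k^2}<\bar r_S$ satisfy $G(\underline r_S,k)=G(\bar r_S,k)=G(r_0,v_0)$.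
   Context: The function $G$ is $G(r,v)=\frac12v^2-k^2\ln(r^2|v|)-\frac{m}{r}$ for $r>0$ (where $|v|=\operatorname{sgn}(v_0)\,v$). Put $S(r,v)=\frac12v^2-k^2\ln(r^2|v|)-\frac mr+\frac32k^2+k^2\ln\frac{m^2}{4k^3}$. A critical steady state solution is one with $S(r,v(r))\equiv0$. For each $r>0$ with $r\ne\frac{m}{2k^2}$ the equation $S(r,v)=0$ has exactly two positive roots $v_1(r)<k<v_2(r)$ and two negative roots $v_3(r)=-v_1(r)$, $v_4(r)=-v_2(r)$. The critical curves on $(0,+\infty)$ are defined as follows, each taking the value $k$ (for $P$) or $-k$ (for $N$) at $r=\frac{m}{2k^2}$: $v_*^{P,\flat}=v_1$ on $(0,\frac{m}{2k^2})$ and $v_2$ on $(\frac{m}{2k^2},+\infty)$; $v_*^{P,\sharp}=v_2$ on $(0,\frac{m}{2k^2})$ and $v_1$ on $(\frac{m}{2k^2},+\infty)$; $v_*^{N,\flat}=v_3$ on $(0,\frac{m}{2k^2})$ and $v_4$ on $(\frac{m}{2k^2},+\infty)$; $v_*^{N,\sharp}=v_4$ on $(0,\frac{m}{2k^2})$ and $v_3$ on $(\frac{m}{2k^2},+\infty)$.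
   Formalization: Existence and uniqueness are stated only for |v_0| ≠ k, as they fail for |v_0| = k (there, in case (ii), existence and the four-curve claim are kept); in case (ii), sgn(|v|-k)=sgn(|v_0|-k) is claimed only for r on the same side of m/(2k^2) as r_0. *)

(* Defs.v *)
From Stdlib Require Export Reals.
From Coquelicot Require Export Coquelicot.

Open Scope R_scope.

Definition G (m k r v : R) : R :=
  / 2 * v ^ 2 - k ^ 2 * ln (r ^ 2 * Rabs v) - m / r.

(* The threshold value of [G], equal to [G m k (m / (2 * k ^ 2)) k]. *)
Definition Gcrit (m k : R) : R :=
  - (3 / 2) * k ^ 2 - k ^ 2 * ln (m ^ 2 / (4 * k ^ 3)).

Definition Scrit (m k r v : R) : R :=
  / 2 * v ^ 2 - k ^ 2 * ln (r ^ 2 * Rabs v) - m / r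
  + 3 / 2 * k ^ 2 + k ^ 2 * ln (m ^ 2 / (4 * k ^ 3)).

Definition sonic_radius (m k : R) : R := m / (2 * k ^ 2).

(* For [r > 0] distinct from the sonic radius, [Scrit m k r] has exactly one
   root in (0, k) and one in (k, +oo); [iota] selects them.  At the sonic
   radius [v1] and [v2] are junk values, not used below. *)
Definition v1 (m k r : R) : R :=
  iota (fun w : R => 0 < w < k /\ Scrit m k r w = 0).
Definition v2 (m k r : R) : R :=
  iota (fun w : R => k < w /\ Scrit m k r w = 0).
Definition v3 (m k r : R) : R := - v1 m k r.
Definition v4 (m k r : R) : R := - v2 m k r.

(* [f] before the sonic radius, the constant [c] at it, [g] after it. *)
Definition glue (m k : R) (f : R -> R) (c : R) (g : R -> R) (r : R) : R :=
  if Rlt_dec r (sonic_radius m k) then f r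
  else if Rlt_dec (sonic_radius m k) r then g r
  else c.

Definition v_P_flat (m k : R) : R -> R := glue m k (v1 m k) k (v2 m k).
Definition v_P_sharp (m k : R) : R -> R := glue m k (v2 m k) k (v1 m k).
Definition v_N_flat (m k : R) : R -> R := glue m k (v3 m k) (- k) (v4 m k).
Definition v_N_sharp (m k : R) : R -> R := glue m k (v4 m k) (- k) (v3 m k).

Definition in_itv (a b : Rbar) (r : R) : Prop := Rbar_lt a r /\ Rbar_lt r b.

Definition smooth_on (a b : Rbar) (f : R -> R) : Prop :=
  forall (n : nat) (r : R), in_itv a b r -> ex_derive_n f n r.

(* Smooth solution of the static Euler model on the open interval (a, b) of
   (0, +oo).  The values of [rho] and [v] outside (a, b) are irrelevant. *)
Definition steady_state (m k : R) (a b : Rbar) (rho v : R -> R) : Prop :=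
  Rbar_le 0 a /\
  smooth_on a b rho /\ smooth_on a b v /\
  (forall r, in_itv a b r ->
     Derive (fun s => s ^ 2 * rho s * v s) r = 0) /\
  (forall r, in_itv a b r ->
     Derive (fun s => s ^ 2 * (v s ^ 2 + k ^ 2) * rho s) r
     - 2 * k ^ 2 * rho r * r + m * rho r = 0).

Definition steady_state_from (m k r0 rho0 v0 : R) (a b : Rbar)
    (rho v : R -> R) : Prop :=
  steady_state m k a b rho v /\
  in_itv a b r0 /\ rho r0 = rho0 /\ v r0 = v0.

(* Solutions live on intervals, so uniqueness means: every smooth solution of
   the initial value problem is a restriction of this (maximal) one. *)
Definition unique_steady_state_from (m k r0 rho0 v0 : R) (a b : Rbar)
    (rho v : R -> R) : Prop :=
  steady_state_from m k r0 rho0 v0 a b rho v /\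
  forall (a' b' : Rbar) (rho' v' : R -> R),
    steady_state_from m k r0 rho0 v0 a' b' rho' v' ->
    forall r, in_itv a' b' r ->
      in_itv a b r /\ rho' r = rho r /\ v' r = v r.

(* [v0 <> 0] discards the junk value [ln 0 = 0]; see [supercritical_G]. *)
Definition critical_G (m k r0 v0 : R) : Prop :=
  v0 <> 0 /\ G m k r0 v0 = Gcrit m k.
Definition subcritical_G (m k r0 v0 : R) : Prop :=
  v0 <> 0 /\ G m k r0 v0 < Gcrit m k.
(* [G m k r0 v] tends to +oo as [v] tends to 0, so [v0 = 0] belongs here. *)
Definition supercritical_G (m k r0 v0 : R) : Prop :=
  v0 = 0 \/ Gcrit m k < G m k r0 v0.

(* A critical solution passes from |v| < k to |v| > k, or conversely, at the
   sonic radius, so that sgn (|v| - k) can only be preserved on the side of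
   the sonic radius that contains [r0]. *)
Definition sign_preserving (m k r0 v0 : R) (a b : Rbar) (v : R -> R) : Prop :=
  forall r, in_itv a b r ->
    sign (v r) = sign v0 /\
    ((critical_G m k r0 v0 ->
        0 < (r - sonic_radius m k) * (r0 - sonic_radius m k)) ->
     sign (Rabs (v r) - k) = sign (Rabs v0 - k)).

Definition critical_on (m k : R) (a b : Rbar) (v : R -> R) : Prop :=
  forall r, in_itv a b r -> Scrit m k r (v r) = 0.

Definition agree_on (a b : Rbar) (f g : R -> R) : Prop :=
  forall r, in_itv a b r -> f r = g r.

Definition is_critical_curve_on (m k : R) (a b : Rbar) (v : R -> R) : Prop :=
  agree_on a b v (v_P_flat m k) \/ agree_on a b v (v_P_sharp m k) \/
  agree_on a b v (v_N_flat m k) \/ agree_on a b v (v_N_sharp m k).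

(* Main.v *)
Require Import Defs.
From Stdlib Require Import Ranalysis5 Lra Lia.

(** Mass conservation makes the flux [r ^ 2 * rho * v] constant; eliminating
    [rho], the momentum equation says that [G] is constant along a solution
    ([steady_state_hyperbola], [steady_state_of_hyperbola]).  So everything is
    about the level curves of [G], and the one delicate point is the sonic point
    [r = m / (2 * k ^ 2)], [|v| = k], where [G] is critical and the ODE for [v]
    is singular.

    With [gap u = u - 1 - ln u] and [rs] the sonic radius, one has
      [G - Gcrit = k ^ 2 / 2 * (gap (v ^ 2 / k ^ 2) - 4 * gap (rs / r))].
    The function [gap] is nonnegative, with a single nondegenerate zero at 1,
    and it is proper on (0, +oo).  Hence it has a global Morse coordinate: there
    is an increasing smooth diffeomorphism [morse] from (0, +oo) onto the line
    with [morse u ^ 2 = 2 * gap u] ([smooth_morse], [smooth_unmorse]).  Writing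
    [W = morse (v ^ 2 / k ^ 2)] and [sigma = morse (rs / r)], which are both
    free to take every real value, the level curves become the hyperbolas
      [W ^ 2 - 4 * sigma ^ 2 = e], where [e = 4 / k ^ 2 * (G - Gcrit)]
    ([G_minus_Gcrit]).  The sign of [W] is that of [|v| - k], and [sigma]
    decreases from +oo to -oo with [sigma rs = 0].  The cases of the theorem are
    those of the sign of [e]:

    - if [e > 0], the curve is a pair of graphs [W = +- sqrt (e + 4 * sigma ^ 2)]
      over the whole line, so the solution is global;
    - if [e < 0], it exists only where [|sigma| > sqrt (- e) / 2], which is a
      pair of half-lines in [sigma], each bounded by a radius where [W = 0], that
      is [|v| = k];
    - if [e = 0], it is the pair of lines [W = +- 2 * sigma], which cross at the
      sonic point.

    Away from [W = 0] a continuous solution cannot change branch, because [W]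
    cannot change sign.  On the critical level, a differentiable solution cannot
    change line at the crossing, because the ratio [W / sigma] extends
    continuously over the sonic radius and only takes the values 2 and -2
    ([critical_branch]).  Conversely each branch is smooth in [r], because
    [morse] and its inverse are.  If [v0 = 0] the gas is at rest and the density
    solves a linear equation ([static_solution]). *)

(** * Germs of smooth functions *)

Fixpoint Cn (n : nat) (f : R -> R) (x : R) : Prop :=
  match n with
  | O => True
  | S p => locally x (ex_derive f) /\ Cn p (Derive f) x
  end.

(** Smoothness of the germ at [x]: all derivatives exist near [x], not only at
    [x].  Asking this on neighbourhoods is what makes the notion stable under
    composition, one order at a time. *)
Definition smooth (f : R -> R) (x : R) : Prop := forall n, Cn n f x.

Lemma Cn_ext_loc n : forall f g x,
  locally x (fun y => f y = g y) -> Cn n f x -> Cn n g x.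
Proof.
  induction n as [|n IH]; intros f g x Hfg Hf; [exact I|].
  destruct Hf as [Hd Hf].
  apply locally_locally in Hfg.
  split.
  - generalize (filter_and _ _ Hfg Hd). apply filter_imp.
    intros y [Hy1 Hy2]. now apply ex_derive_ext_loc with f.
  - apply IH with (Derive f); [|exact Hf].
    revert Hfg. apply filter_imp. intros y Hy. now apply Derive_ext_loc.
Qed.

Lemma smooth_ext_loc (f g : R -> R) (x : R) :
  locally x (fun y => f y = g y) -> smooth f x -> smooth g x.
Proof. intros Hfg Hf n. now apply Cn_ext_loc with f. Qed.

Lemma Cn_S n : forall f x, Cn (S n) f x -> Cn n f x.
Proof.
  induction n as [|n IH]; intros f x H; [exact I|].
  destruct H as [Hd H]. split; [exact Hd|]. now apply IH.
Qed.

Lemma smooth_ex_derive f x : smooth f x -> ex_derive f x.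
Proof. intros H. destruct (H 1%nat) as [Hd _]. exact (locally_singleton _ _ Hd). Qed.

Lemma smooth_continuous f x : smooth f x -> continuous f x.
Proof.
  intros H. apply (ex_derive_continuous (K := R_AbsRing) (V := R_NormedModule)).
  now apply smooth_ex_derive.
Qed.

Lemma smooth_ex_derive_n f x n : smooth f x -> ex_derive_n f n x.
Proof.
  intros H. destruct n as [|n]; [exact I|].
  generalize (H (S n)). clear H. revert f.
  induction n as [|n IH]; intros f [Hd Hf].
  - exact (locally_singleton _ _ Hd).
  - apply IH in Hf. simpl in Hf |- *.
    apply ex_derive_ext with (2 := Hf).
    intros t. rewrite (Derive_n_comp f n 1). now rewrite Nat.add_1_r.
Qed.

Lemma Cn_const n c x : Cn n (fun _ => c) x.
Proof.
  revert c. induction n as [|n IH]; intros c; [exact I|]. split.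
  - apply filter_forall. intros y. apply ex_derive_const.
  - apply Cn_ext_loc with (fun _ => 0); [|apply IH].
    apply filter_forall. intros y. now rewrite Derive_const.
Qed.

Lemma smooth_const c x : smooth (fun _ => c) x.
Proof. intros n. apply Cn_const. Qed.

Lemma smooth_id x : smooth (fun y => y) x.
Proof.
  intros [|n]; [exact I|]. split.
  - apply filter_forall. intros y. apply ex_derive_id.
  - apply Cn_ext_loc with (fun _ => 1); [|apply Cn_const].
    apply filter_forall. intros y. now rewrite Derive_id.
Qed.

Lemma Cn_plus n : forall f g x, Cn n f x -> Cn n g x -> Cn n (fun y => f y + g y) x.
Proof.
  induction n as [|n IH]; intros f g x Hf Hg; [exact I|].
  destruct Hf as [Hdf Hf], Hg as [Hdg Hg].
  generalize (filter_and _ _ Hdf Hdg); intros Hd. split.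
  - revert Hd. apply filter_imp. intros y [H1 H2].
    apply @ex_derive_plus with (1 := H1) (2 := H2).
  - apply Cn_ext_loc with (fun y => Derive f y + Derive g y); [|now apply IH].
    revert Hd. apply filter_imp. intros y [H1 H2]. now rewrite Derive_plus.
Qed.

Lemma smooth_plus f g x : smooth f x -> smooth g x -> smooth (fun y => f y + g y) x.
Proof. intros Hf Hg n. now apply Cn_plus. Qed.

Lemma Cn_mult n : forall f g x, Cn n f x -> Cn n g x -> Cn n (fun y => f y * g y) x.
Proof.
  induction n as [|n IH]; intros f g x Hf Hg; [exact I|].
  generalize (Cn_S _ _ _ Hf) (Cn_S _ _ _ Hg); intros Hf0 Hg0.
  destruct Hf as [Hdf Hf], Hg as [Hdg Hg].
  generalize (filter_and _ _ Hdf Hdg); intros Hd. split.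
  - revert Hd. apply filter_imp. intros y [H1 H2].
    now apply ex_derive_mult.
  - apply Cn_ext_loc with (fun y => Derive f y * g y + f y * Derive g y).
    + revert Hd. apply filter_imp. intros y [H1 H2]. now rewrite Derive_mult.
    + apply Cn_plus; now apply IH.
Qed.

Lemma smooth_mult f g x : smooth f x -> smooth g x -> smooth (fun y => f y * g y) x.
Proof. intros Hf Hg n. now apply Cn_mult. Qed.

Lemma Cn_comp n : forall f g x,
  Cn n f (g x) -> Cn n g x -> Cn n (fun y => f (g y)) x.
Proof.
  induction n as [|n IH]; intros f g x Hf Hg; [exact I|].
  generalize (Cn_S _ _ _ Hg); intros Hg0.
  destruct Hf as [Hdf Hf], Hg as [Hdg Hg].
  assert (Hc : continuous g x).
  { apply (ex_derive_continuous (K := R_AbsRing) (V := R_NormedModule)).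
    exact (locally_singleton _ _ Hdg). }
  assert (Hdfg : locally x (fun y => ex_derive f (g y))) by exact (Hc _ Hdf).
  generalize (filter_and _ _ Hdfg Hdg); intros Hd. split.
  - revert Hd. apply filter_imp. intros y [H1 H2].
    now apply ex_derive_comp.
  - apply Cn_ext_loc with (fun y => Derive g y * Derive f (g y)).
    + revert Hd. apply filter_imp. intros y [H1 H2]. symmetry. now apply Derive_comp.
    + apply Cn_mult; [exact Hg|]. now apply IH.
Qed.

Lemma smooth_comp f g x : smooth f (g x) -> smooth g x -> smooth (fun y => f (g y)) x.
Proof. intros Hf Hg n. now apply Cn_comp. Qed.

(** The bootstrap for solutions of [f' = F (f)]: [f] inherits one more
    derivative than it already has.  It gives the smoothness of [Rinv], [sqrt],
    [exp], [ln] and of inverse functions. *)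
Lemma smooth_autonomous (f F : R -> R) (x : R) :
  locally x (fun y => is_derive f y (F (f y))) -> smooth F (f x) -> smooth f x.
Proof.
  intros Hd HF n. induction n as [|n IH]; [exact I|]. split.
  - revert Hd. apply filter_imp. intros y Hy. now exists (F (f y)).
  - apply Cn_ext_loc with (fun y => F (f y)); [|now apply Cn_comp].
    revert Hd. apply filter_imp. intros y Hy. symmetry.
    now apply is_derive_unique.
Qed.

Lemma locally_neq0 (x : R) : x <> 0 -> locally x (fun y : R => y <> 0).
Proof.
  intros Hx. destruct (Rdichotomy _ _ Hx) as [H|H].
  - apply locally_interval with m_infty (Finite 0); [exact I|exact H|].
    simpl. intros; lra.
  - apply locally_interval with (Finite 0) p_infty; [exact H|exact I|].
    simpl. intros; lra.
Qed.

Lemma locally_gt (c x : R) : c < x -> locally x (fun y : R => c < y).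
Proof.
  intros H. apply locally_interval with (Finite c) p_infty; [exact H|exact I|].
  simpl. intros; lra.
Qed.

Lemma locally_lt (c x : R) : x < c -> locally x (fun y : R => y < c).
Proof.
  intros H. apply locally_interval with m_infty (Finite c); [exact I|exact H|].
  simpl. intros; lra.
Qed.

Lemma smooth_inv x : x <> 0 -> smooth Rinv x.
Proof.
  intros Hx. apply smooth_autonomous with (fun y => -1 * (y * y)).
  - generalize (locally_neq0 x Hx). apply filter_imp. intros y Hy.
    auto_derive; [exact Hy|]. now field.
  - apply smooth_mult; [apply smooth_const|].
    apply smooth_mult; apply smooth_id.
Qed.

Lemma smooth_div f g x :
  smooth f x -> smooth g x -> g x <> 0 -> smooth (fun y => f y / g y) x.
Proof.
  intros Hf Hg H. apply smooth_mult; [exact Hf|].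
  apply smooth_comp with (f := Rinv); [now apply smooth_inv|exact Hg].
Qed.

Lemma smooth_sqrt x : 0 < x -> smooth sqrt x.
Proof.
  intros Hx. apply smooth_autonomous with (fun y => / (2 * y)).
  - generalize (locally_gt 0 x Hx). apply filter_imp. intros y Hy.
    auto_derive; [exact Hy|]. field. apply Rgt_not_eq. now apply sqrt_lt_R0.
  - apply smooth_comp with (f := Rinv).
    + apply smooth_inv. apply sqrt_lt_R0 in Hx. lra.
    + apply smooth_mult; [apply smooth_const|apply smooth_id].
Qed.

Lemma smooth_exp x : smooth exp x.
Proof.
  apply smooth_autonomous with (fun y => y); [|apply smooth_id].
  apply filter_forall. intros y. auto_derive; [exact I|ring].
Qed.

Lemma smooth_ln x : 0 < x -> smooth ln x.
Proof.
  intros Hx. apply smooth_autonomous with (fun y => / exp y).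
  - generalize (locally_gt 0 x Hx). apply filter_imp. intros y Hy.
    rewrite exp_ln by exact Hy. now apply is_derive_ln.
  - apply smooth_comp with (f := Rinv); [|apply smooth_exp].
    apply smooth_inv. apply Rgt_not_eq, exp_pos.
Qed.

Lemma smooth_PSeries a x : Rbar_lt (Rabs x) (CV_radius a) -> smooth (PSeries a) x.
Proof.
  intros H n. revert a H. induction n as [|n IH]; intros a H; [exact I|].
  assert (Hloc : locally x (fun y => Rbar_lt (Rabs y) (CV_radius a))).
  { assert (Hc : continuous Rabs x) by apply continuous_Rabs.
    apply (Hc (fun z => Rbar_lt z (CV_radius a))).
    now apply open_Rbar_lt. }
  split.
  - revert Hloc. apply filter_imp. intros y Hy. now apply ex_derive_PSeries.
  - apply Cn_ext_loc with (PSeries (PS_derive a)).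
    + revert Hloc. apply filter_imp. intros y Hy. now rewrite Derive_PSeries.
    + apply IH. now rewrite CV_radius_derive.
Qed.

(** Differentiability of an inverse function at a point where the inverse is
    known to be continuous.  Writing [D] for the increment of [g], the
    differentiability of [f] first bounds [|D|] by [2 * |h| / |l|], and then
    turns the error of [f] at [D] into an error of [g] at [h]. *)
Lemma is_derive_local_inverse (f g : R -> R) (x l : R) :
  locally x (fun y => f (g y) = y) -> continuous g x ->
  is_derive f (g x) l -> l <> 0 -> is_derive g x (/ l).
Proof.
  intros Hfg Hc Hf Hl.
  assert (Hlp : 0 < Rabs l) by now apply Rabs_pos_lt.
  apply is_derive_Reals. apply is_derive_Reals in Hf.
  assert (Hx : f (g x) = x) by exact (locally_singleton _ _ Hfg).
  intros eps Heps.
  (* the first bound gives [|D| <= 2 * |h| / |l|], the second the final estimate *)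
  set (e := Rmin (Rabs l / 2) (eps * (Rabs l * Rabs l) / 4)).
  assert (He : 0 < e).
  { apply Rmin_case; [lra|].
    apply Rdiv_lt_0_compat; [|lra]. apply Rmult_lt_0_compat; [exact Heps|nra]. }
  assert (He1 : e <= Rabs l / 2) by apply Rmin_l.
  assert (He2 : e <= eps * (Rabs l * Rabs l) / 4) by apply Rmin_r.
  destruct (Hf e He) as [d Hd].
  assert (Hcl : locally x (fun y => Rabs (g y - g x) < d)).
  { apply (Hc (fun z => Rabs (z - g x) < d)). exists d. intros z Hz. exact Hz. }
  destruct (filter_and _ _ Hfg Hcl) as [d' Hd'].
  exists d'. intros h Hh0 Hh.
  assert (Hb : Rabs (x + h - x) < d') by now replace (x + h - x) with h by ring.
  destruct (Hd' (x + h) Hb) as [Hfh Hgh].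
  set (D := g (x + h) - g x) in *.
  assert (HD : D <> 0).
  { intros H0. apply Hh0.
    assert (g (x + h) = g x) by (unfold D in H0; lra).
    rewrite H, Hx in Hfh. lra. }
  specialize (Hd D HD Hgh).
  replace (g x + D) with (g (x + h)) in Hd by (unfold D; ring).
  rewrite Hfh, Hx in Hd. replace (x + h - x) with h in Hd by ring.
  replace (h / D - l) with ((h - l * D) / D) in Hd by (field; exact HD).
  unfold Rdiv in Hd. rewrite Rabs_mult, Rabs_inv in Hd.
  assert (HDp : 0 < Rabs D) by now apply Rabs_pos_lt.
  assert (Hhp : 0 < Rabs h) by now apply Rabs_pos_lt.
  assert (H1 : Rabs (h - l * D) < e * Rabs D).
  { apply Rmult_lt_reg_r with (/ Rabs D); [now apply Rinv_0_lt_compat|].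
    rewrite Rmult_assoc, Rinv_r, Rmult_1_r; [exact Hd|lra]. }
  assert (H2 : Rabs l * Rabs D <= Rabs h + Rabs (h - l * D)).
  { rewrite <- Rabs_mult. replace (l * D) with (h - (h - l * D)) by ring.
    eapply Rle_trans; [apply Rabs_triang|]. rewrite Rabs_Ropp.
    replace (h - (h - (h - l * D))) with (h - l * D) by ring. lra. }
  assert (H3 : Rabs l * Rabs D <= 2 * Rabs h) by nra.
  replace (D / h - / l) with (- ((h - l * D) / (l * h))) by (field; tauto).
  rewrite Rabs_Ropp. unfold Rdiv. rewrite Rabs_mult, Rabs_inv, Rabs_mult.
  apply Rmult_lt_reg_r with (Rabs l * Rabs h); [nra|].
  rewrite Rmult_assoc, Rinv_l, Rmult_1_r by nra.
  apply Rlt_le_trans with (1 := H1).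
  apply Rle_trans with (eps * (Rabs l * Rabs l) / 4 * Rabs D); [nra|].
  replace (eps * (Rabs l * Rabs l) / 4 * Rabs D)
    with (eps * Rabs l / 4 * (Rabs l * Rabs D)) by field.
  apply Rle_trans with (eps * Rabs l / 4 * (2 * Rabs h)); [|nra].
  apply Rmult_le_compat_l; [nra|exact H3].
Qed.

(** * Functions on an interval *)

Lemma in_itv_between a b x y z :
  in_itv a b x -> in_itv a b y -> x <= z <= y -> in_itv a b z.
Proof.
  intros [Hax Hxb] [Hay Hyb] [H1 H2]. split.
  - apply Rbar_lt_le_trans with x; [exact Hax|exact H1].
  - apply Rbar_le_lt_trans with y; [exact H2|exact Hyb].
Qed.

Lemma in_itv_locally a b x : in_itv a b x -> locally x (in_itv a b).
Proof.
  intros [Ha Hb]. apply locally_interval with a b; [exact Ha|exact Hb|].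
  intros y H1 H2. now split.
Qed.

Lemma constant_on_itv (a b : Rbar) (f : R -> R) (x y : R) :
  (forall z, in_itv a b z -> is_derive f z 0) ->
  in_itv a b x -> in_itv a b y -> f x = f y.
Proof.
  assert (Hlt : forall x y, (forall z, in_itv a b z -> is_derive f z 0) ->
    in_itv a b x -> in_itv a b y -> x < y -> f x = f y).
  { intros p q Hd Hp Hq Hpq. apply @eq_is_derive; [|exact Hpq].
    intros t Ht. apply Hd. now apply in_itv_between with p q. }
  intros Hd Hx Hy. destruct (Rtotal_order x y) as [H|[H|H]].
  - now apply Hlt.
  - now rewrite H.
  - symmetry. now apply Hlt.
Qed.

Lemma sign_constant_on_itv (a b : Rbar) (f : R -> R) (x y : R) :
  (forall z, in_itv a b z -> continuous f z) ->
  (forall z, in_itv a b z -> f z <> 0) ->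
  in_itv a b x -> in_itv a b y -> sign (f x) = sign (f y).
Proof.
  assert (Hlt : forall f, (forall z, in_itv a b z -> continuous f z) ->
    (forall z, in_itv a b z -> f z <> 0) -> forall x y,
    in_itv a b x -> in_itv a b y -> x < y -> f x < 0 -> f y < 0).
  { intros h Hc Hn p q Hp Hq Hpq Hfp.
    destruct (Rlt_or_le (h q) 0) as [H|H]; [exact H|exfalso].
    assert (Hfq : 0 < h q) by (generalize (Hn q Hq); lra).
    destruct (IVT_interv h p q) as [z [Hz Hz0]]; try assumption.
    - intros z Hz. apply continuity_pt_filterlim.
      apply Hc. now apply in_itv_between with p q.
    - apply (Hn z); [now apply in_itv_between with p q|exact Hz0]. }
  assert (Hlt' : forall x y, (forall z, in_itv a b z -> continuous f z) ->
    (forall z, in_itv a b z -> f z <> 0) ->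
    in_itv a b x -> in_itv a b y -> x < y -> sign (f x) = sign (f y)).
  { intros p q Hc Hn Hp Hq Hpq.
    destruct (Rdichotomy _ _ (Hn p Hp)) as [H|H].
    - rewrite !sign_eq_m1; [reflexivity| |exact H]. now apply (Hlt f Hc Hn p q).
    - rewrite !sign_eq_1; [reflexivity| |exact H].
      apply Ropp_lt_cancel. rewrite Ropp_0.
      apply (Hlt (fun z => - f z)) with p; try assumption; try lra.
      + intros z Hz. apply @continuous_opp. now apply Hc.
      + intros z Hz. specialize (Hn z Hz). lra. }
  intros Hc Hn Hx Hy. destruct (Rtotal_order x y) as [H|[H|H]].
  - now apply Hlt'.
  - now rewrite H.
  - symmetry. now apply Hlt'.
Qed.

(** * The Morse coordinate of u - 1 - ln u *)

(** The convex function [u - 1 - ln u], of which both the kinetic and the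
    radial part of [G] are instances. *)
Definition gap (u : R) : R := u - 1 - ln u.

(** The Morse coordinate of [gap]: the square root of [2 * gap] with the sign
    that makes it increasing, so that the double zero becomes a simple one. *)
Definition morse (u : R) : R := sign (u - 1) * sqrt (2 * gap u).

Lemma is_derive_gap u : 0 < u -> is_derive gap u (1 - / u).
Proof. intros Hu. unfold gap. auto_derive; [exact Hu|]. field. lra. Qed.

Lemma gap_1 : gap 1 = 0.
Proof. unfold gap. rewrite ln_1. ring. Qed.

Lemma gap_pos u : 0 < u -> u <> 1 -> 0 < gap u.
Proof.
  intros Hu H1. unfold gap.
  assert (Hl : ln u <> 0).
  { intros H0. apply H1. rewrite <- (exp_ln u Hu), H0. apply exp_0. }
  generalize (exp_ineq1 (ln u) Hl). rewrite exp_ln by exact Hu. lra.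
Qed.

Lemma gap_nonneg u : 0 < u -> 0 <= gap u.
Proof.
  intros Hu. destruct (Req_dec u 1) as [->|H]; [rewrite gap_1; lra|].
  now apply Rlt_le, gap_pos.
Qed.

(** The power series of the logarithm exhibits the double zero of [gap] at 1 as
    a square times a smooth function.  This is the only place where smoothness
    has to be obtained across a removable singularity. *)
Lemma gap_double_zero :
  exists P : R -> R, smooth P 1 /\ P 1 = / 2 /\
    locally 1 (fun u => gap u = (u - 1) ^ 2 * P u).
Proof.
  set (b := fun n : nat => (-1) ^ n).
  set (c := fun n : nat => (-1) ^ n / INR (n + 2)).
  set (a := PS_incr_1 (PS_incr_1 c)).
  assert (Hn : forall n, INR (n + 2) <> 0).
  { intros n. apply not_0_INR. lia. }
  assert (Hb0 : forall n, b n <> 0).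
  { intros n. apply pow_nonzero. lra. }
  assert (Hb : CV_radius b = Finite 1).
  { replace (Finite 1) with (Finite (/ 1)) by (f_equal; field).
    apply CV_radius_finite_DAlembert; [exact Hb0|lra|].
    apply is_lim_seq_ext with (fun _ => 1); [|apply is_lim_seq_const].
    intros n. unfold b at 1. simpl pow. fold (b n).
    replace (-1 * b n / b n) with (-1) by (field; apply Hb0).
    rewrite Rabs_left by lra. ring. }
  assert (Hda : forall n, PS_derive a n = PS_incr_1 b n).
  { intros [|n]; unfold PS_derive, a, PS_incr_1.
    - simpl. apply Rmult_0_r.
    - unfold c, b. replace (n + 2)%nat with (S (S n)) by lia.
      field. apply not_0_INR. lia. }
  assert (Ha : CV_radius a = Finite 1).
  { rewrite <- CV_radius_derive.
    rewrite (CV_radius_ext _ _ Hda), CV_radius_incr_1. exact Hb. }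
  assert (Hc : CV_radius c = Finite 1).
  { rewrite <- Ha. unfold a. now rewrite !CV_radius_incr_1. }
  (* [a], the series of [x ^ 2 * PSeries c x], has derivative [x / (1 + x)] *)
  assert (Hgeom : forall x, Rabs x < 1 -> PSeries b x = / (1 + x)).
  { intros x Hx. apply is_pseries_unique. apply is_pseries_R.
    replace (/ (1 + x)) with (/ (1 - - x)) by (f_equal; ring).
    apply is_series_ext with (fun n => (- x) ^ n).
    - intros n. unfold b. rewrite <- Rpow_mult_distr. f_equal. ring.
    - apply is_series_geom. now rewrite Rabs_Ropp. }
  assert (Hgap : forall x, Rabs x < 1 -> gap (1 + x) = PSeries a x).
  { intros x Hx.
    assert (H : gap (1 + x) - PSeries a x = gap (1 + 0) - PSeries a 0).
    { apply (constant_on_itv (-1) 1 (fun y => gap (1 + y) - PSeries a y)).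
      - intros z [H1 H2]. simpl in H1, H2.
        assert (Hz : Rabs z < 1) by now apply Rabs_def1.
        replace 0 with ((1 - / (1 + z)) - PSeries (PS_derive a) z).
        + apply @is_derive_minus.
          * replace (1 - / (1 + z)) with (scal 1 (1 - / (1 + z)))
              by apply Rmult_1_l.
            apply (is_derive_comp gap (fun y => 1 + y)).
            -- apply is_derive_gap. lra.
            -- auto_derive; [exact I|ring].
          * apply is_derive_PSeries. rewrite Ha. exact Hz.
        + rewrite (PSeries_ext _ _ z Hda), PSeries_incr_1, (Hgeom z Hz).
          field. lra.
      - apply Rabs_def2 in Hx. split; simpl; lra.
      - split; simpl; lra. }
    unfold a in H at 2. rewrite PSeries_incr_1, Rplus_0_r, gap_1 in H. lra. }
  exists (fun u => PSeries c (u - 1)). split; [|split].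
  - apply smooth_comp with (f := PSeries c).
    + apply smooth_PSeries. rewrite Hc, Rminus_diag, Rabs_R0. simpl. lra.
    + apply smooth_plus; [apply smooth_id|apply smooth_const].
  - rewrite Rminus_diag, PSeries_0. unfold c. simpl. field.
  - apply locally_interval with (Finite 0) (Finite 2); simpl; try lra.
    intros u H1 H2. replace u with (1 + (u - 1)) at 1 by ring.
    rewrite Hgap by (apply Rabs_def1; lra).
    unfold a. rewrite !PSeries_incr_1. ring.
Qed.

Lemma morse_sqr u : 0 < u -> morse u ^ 2 = 2 * gap u.
Proof.
  intros Hu. unfold morse. rewrite Rpow_mult_distr, pow2_sqrt.
  2: generalize (gap_nonneg u Hu); lra.
  destruct (Rtotal_order u 1) as [H|[H|H]].
  - rewrite sign_eq_m1 by lra. ring.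
  - rewrite H, gap_1. ring.
  - rewrite sign_eq_1 by lra. ring.
Qed.

Lemma sign_morse u : 0 < u -> sign (morse u) = sign (u - 1).
Proof.
  intros Hu. unfold morse. destruct (Req_dec u 1) as [->|H].
  - rewrite Rminus_diag, sign_0, Rmult_0_l. apply sign_0.
  - rewrite sign_mult, (sign_eq_1 (sqrt _)); [|apply sqrt_lt_R0].
    + rewrite Rmult_1_r. destruct (Rdichotomy _ _ H).
      * rewrite (sign_eq_m1 (u - 1)) by lra. apply sign_eq_m1. lra.
      * rewrite (sign_eq_1 (u - 1)) by lra. apply sign_eq_1. lra.
    + generalize (gap_pos u Hu H). lra.
Qed.

Lemma morse_1 : morse 1 = 0.
Proof. unfold morse. rewrite Rminus_diag, sign_0. ring. Qed.

(** Taking the square root of the factorization of [gap] removes the absolute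
    value: this makes [morse] smooth at 1 in spite of the square root. *)
Lemma morse_simple_zero :
  exists Q : R -> R, smooth Q 1 /\ 0 < Q 1 /\
    locally 1 (fun u => (u - 1) * Q u = morse u).
Proof.
  destruct gap_double_zero as [P [HP [HP1 Hgap]]].
  assert (HPpos : locally 1 (fun u => 0 < P u)).
  { apply (smooth_continuous P 1 HP (fun z => 0 < z)).
    apply locally_gt. rewrite HP1. lra. }
  exists (fun u => sqrt (2 * P u)). split; [|split].
  - apply smooth_comp with (f := sqrt).
    + apply smooth_sqrt. rewrite HP1. lra.
    + apply smooth_mult; [apply smooth_const|exact HP].
  - apply sqrt_lt_R0. rewrite HP1. lra.
  - generalize (filter_and _ _ Hgap HPpos). apply filter_imp.
    intros u [H1 H2]. unfold morse. rewrite H1.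
    replace (2 * ((u - 1) ^ 2 * P u)) with ((u - 1) ^ 2 * (2 * P u)) by ring.
    rewrite (sqrt_mult ((u - 1) ^ 2)) by (apply pow2_ge_0 || lra).
    rewrite <- Rsqr_pow2, sqrt_Rsqr_abs.
    rewrite <- Rmult_assoc. f_equal.
    destruct (Rtotal_order u 1) as [H|[H|H]].
    + rewrite sign_eq_m1, Rabs_left by lra. ring.
    + rewrite H, Rminus_diag, Rabs_R0. ring.
    + rewrite sign_eq_1, Rabs_pos_eq by lra. ring.
Qed.

Lemma smooth_gap u : 0 < u -> smooth gap u.
Proof.
  intros Hu. apply smooth_ext_loc with (fun y => (y + -1) + -1 * ln y).
  - apply filter_forall. intros y. unfold gap. ring.
  - apply smooth_plus.
    + apply smooth_plus; [apply smooth_id|apply smooth_const].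
    + apply smooth_mult; [apply smooth_const|now apply smooth_ln].
Qed.

Lemma smooth_morse u : 0 < u -> smooth morse u.
Proof.
  intros Hu. destruct (Req_dec u 1) as [->|H].
  - destruct morse_simple_zero as [Q [HQ [_ Hloc]]].
    apply smooth_ext_loc with (1 := Hloc).
    apply smooth_mult; [|exact HQ].
    apply smooth_plus; [apply smooth_id|apply smooth_const].
  - apply smooth_ext_loc with (fun y => sign (u - 1) * sqrt (2 * gap y)).
    + destruct (Rdichotomy _ _ H) as [H'|H'].
      * generalize (locally_lt 1 u H'). apply filter_imp. intros y Hy.
        unfold morse. now rewrite !sign_eq_m1 by lra.
      * generalize (locally_gt 1 u H'). apply filter_imp. intros y Hy.
        unfold morse. now rewrite !sign_eq_1 by lra.
    + apply smooth_mult; [apply smooth_const|].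
      apply smooth_comp with (f := sqrt).
      * apply smooth_sqrt. generalize (gap_pos u Hu H). lra.
      * apply smooth_mult; [apply smooth_const|now apply smooth_gap].
Qed.

Lemma is_derive_morse u : 0 < u -> is_derive morse u (Derive morse u).
Proof.
  intros Hu. apply Derive_correct. now apply smooth_ex_derive, smooth_morse.
Qed.

(** Away from 1, differentiating [morse ^ 2 = 2 * gap] gives
    [morse * morse' = 1 - / u], whose two sides have the sign of [u - 1].  At 1
    the relation degenerates and the factorization is used instead. *)
Lemma Derive_morse_pos u : 0 < u -> 0 < Derive morse u.
Proof.
  intros Hu. destruct (Req_dec u 1) as [->|H].
  - destruct morse_simple_zero as [Q [HQ [HQ1 Hloc]]].
    rewrite <- (Derive_ext_loc _ _ _ Hloc).
    rewrite Derive_mult.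
    + rewrite Rminus_diag, Rmult_0_l, Rplus_0_r.
      replace (Derive (fun x => x - 1) 1) with 1; [lra|].
      symmetry. apply is_derive_unique. auto_derive; [exact I|ring].
    + auto_derive. exact I.
    + now apply smooth_ex_derive.
  - assert (Hd : morse u * Derive morse u = 1 - / u).
    { apply Rmult_eq_reg_l with 2; [|lra].
      transitivity (Derive (fun y => 2 * gap y) u).
      - transitivity (Derive (fun y => morse y * morse y) u).
        + rewrite Derive_mult by now apply smooth_ex_derive, smooth_morse. ring.
        + apply Derive_ext_loc. generalize (locally_gt 0 u Hu).
          apply filter_imp. intros y Hy. rewrite <- morse_sqr by exact Hy. ring.
      - rewrite Derive_scal. f_equal. apply is_derive_unique.
        now apply is_derive_gap. }
    assert (Hs := sign_morse u Hu).
    assert (Hsq := morse_sqr u Hu). generalize (gap_pos u Hu H); intros Hg.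
    assert (Hu' : u * / u = 1) by (field; lra).
    assert (Hup : 0 < / u) by now apply Rinv_0_lt_compat.
    destruct (Rdichotomy _ _ H) as [H'|H'].
    + rewrite (sign_eq_m1 (u - 1)) in Hs by lra.
      assert (morse u < 0).
      { destruct (Rtotal_order (morse u) 0) as [?|[H0|H0]]; [assumption| |].
        - rewrite H0, sign_0 in Hs. lra.
        - rewrite sign_eq_1 in Hs by exact H0. lra. }
      assert (1 - / u < 0) by nra. nra.
    + rewrite (sign_eq_1 (u - 1)) in Hs by lra.
      assert (0 < morse u).
      { destruct (Rtotal_order (morse u) 0) as [H0|[H0|?]]; [| |assumption].
        - rewrite sign_eq_m1 in Hs by exact H0. lra.
        - rewrite H0, sign_0 in Hs. lra. }
      assert (0 < 1 - / u) by nra. nra.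
Qed.

Lemma morse_increasing u w : 0 < u -> u < w -> morse u < morse w.
Proof.
  intros Hu Hw.
  apply (incr_function morse (Finite 0) p_infty (Derive morse)); try assumption.
  - intros x Hx _. now apply is_derive_morse.
  - intros x Hx _. now apply Derive_morse_pos.
  - exact I.
Qed.

Lemma morse_inj u w : 0 < u -> 0 < w -> morse u = morse w -> u = w.
Proof.
  intros Hu Hw H. destruct (Rtotal_order u w) as [H'|[H'|H']]; [|exact H'|].
  - apply (morse_increasing u w Hu) in H'. lra.
  - apply (morse_increasing w u Hw) in H'. lra.
Qed.

(** The intermediate value theorem between two explicit points where
    [morse ^ 2 > t ^ 2].  Near 0 the logarithm in [gap] dominates; near infinity
    [ln u <= 2 * (sqrt u - 1)], which is again [0 <= gap (sqrt u)]. *)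
Lemma morse_surjective t : {u | 0 < u /\ morse u = t}.
Proof.
  set (lo := exp (- (2 + t ^ 2))). set (hi := (2 + Rabs t) ^ 2).
  assert (Hlo : 0 < lo) by apply exp_pos.
  assert (Ht : 0 <= Rabs t) by apply Rabs_pos.
  assert (Htt : Rabs t ^ 2 = t ^ 2) by (apply pow2_abs).
  assert (Hlo1 : lo < 1).
  { rewrite <- exp_0. apply exp_increasing. nra. }
  assert (Hhi : 1 < hi) by (unfold hi; nra).
  assert (Hmlo : morse lo < t).
  { assert (H1 := morse_sqr lo Hlo).
    unfold gap in H1. unfold lo at 3 in H1. rewrite ln_exp in H1.
    assert (H2 : morse lo < 0).
    { rewrite <- morse_1. now apply morse_increasing. }
    nra. }
  assert (Hmhi : t < morse hi).
  { assert (H1 := morse_sqr hi ltac:(lra)).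
    assert (H2 : 0 < morse hi).
    { rewrite <- morse_1. apply morse_increasing; lra. }
    assert (H3 : ln hi <= 2 * (1 + Rabs t)).
    { unfold hi. simpl pow. rewrite Rmult_1_r, ln_mult by lra.
      assert (H4 := gap_nonneg (2 + Rabs t) ltac:(lra)). unfold gap in H4. lra. }
    assert (H4 : t <= Rabs t) by apply Rle_abs.
    unfold gap in H1. unfold hi at 2 in H1. nra. }
  destruct (IVT_interv (fun u => morse u - t) lo hi) as [u [Hu1 Hu2]]; try lra.
  - intros u Hu. apply continuity_pt_filterlim.
    apply (smooth_continuous (fun y => morse y + - t)).
    apply smooth_plus; [apply smooth_morse; lra|apply smooth_const].
  - exists u. split; lra.
Qed.

Definition unmorse (t : R) : R := proj1_sig (morse_surjective t).

Lemma unmorse_pos t : 0 < unmorse t.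
Proof. exact (proj1 (proj2_sig (morse_surjective t))). Qed.

Lemma morse_unmorse t : morse (unmorse t) = t.
Proof. exact (proj2 (proj2_sig (morse_surjective t))). Qed.

Lemma unmorse_morse u : 0 < u -> unmorse (morse u) = u.
Proof.
  intros Hu. apply morse_inj; [apply unmorse_pos|exact Hu|apply morse_unmorse].
Qed.

Lemma unmorse_increasing s t : s < t -> unmorse s < unmorse t.
Proof.
  intros H. destruct (Rlt_or_le (unmorse s) (unmorse t)) as [?|[H'|H']]; [assumption| |].
  - apply (morse_increasing _ _ (unmorse_pos t)) in H'.
    rewrite !morse_unmorse in H'. lra.
  - apply (f_equal morse) in H'. rewrite !morse_unmorse in H'. lra.
Qed.

(** The inverse of an increasing function is continuous, since the values of
    [morse] at [u - e] and [u + e] enclose a neighbourhood of [t]. *)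
Lemma continuous_unmorse t : continuous unmorse t.
Proof.
  intros P [eps HP].
  set (u := unmorse t).
  assert (Hu : 0 < u) by apply unmorse_pos.
  set (e := Rmin eps (u / 2)).
  assert (He : 0 < e) by (apply Rmin_case; [apply cond_pos|lra]).
  assert (He1 : e <= eps) by apply Rmin_l.
  assert (He2 : e <= u / 2) by apply Rmin_r.
  assert (Hmu : morse u = t) by apply morse_unmorse.
  assert (H1 : morse (u - e) < t) by (rewrite <- Hmu; apply morse_increasing; lra).
  assert (H2 : t < morse (u + e)) by (rewrite <- Hmu; apply morse_increasing; lra).
  apply locally_interval with (Finite (morse (u - e))) (Finite (morse (u + e)));
    [exact H1|exact H2|].
  intros s Hs1 Hs2. simpl in Hs1, Hs2. apply HP.
  apply unmorse_increasing in Hs1, Hs2. rewrite unmorse_morse in Hs1, Hs2 by lra.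
  apply Rabs_def1; unfold minus, plus, opp; simpl; fold u; lra.
Qed.

Lemma smooth_unmorse t : smooth unmorse t.
Proof.
  apply smooth_autonomous with (fun u => / Derive morse u).
  - apply filter_forall. intros s. apply is_derive_local_inverse with morse.
    + apply filter_forall. apply morse_unmorse.
    + apply continuous_unmorse.
    + apply is_derive_morse, unmorse_pos.
    + apply Rgt_not_eq. apply Derive_morse_pos, unmorse_pos.
  - apply smooth_comp with (f := Rinv).
    + apply smooth_inv, Rgt_not_eq, Derive_morse_pos, unmorse_pos.
    + intros n. apply (smooth_morse (unmorse t) (unmorse_pos t) (S n)).
Qed.

(** * The phase plane *)

(** The ordinate [W] of the phase plane in which the level sets of [G] are
    hyperbolas; [v ^ 2 / k ^ 2] is the square of the Mach number. *)
Definition mach (k v : R) : R := morse (v ^ 2 / k ^ 2).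

(** The abscissa [sigma] of the same plane. *)
Definition radial (m k r : R) : R := morse (sonic_radius m k / r).

(** The inverse of [radial m k]. *)
Definition radius_at (m k t : R) : R := sonic_radius m k / unmorse t.

(** The inverse of [mach k] on the velocities of sign [s]. *)
Definition velocity_at (k s w : R) : R := s * k * sqrt (unmorse w).

Lemma sonic_radius_pos m k : 0 < m -> 0 < k -> 0 < sonic_radius m k.
Proof. intros Hm Hk. apply Rdiv_lt_0_compat; [exact Hm|nra]. Qed.

Lemma mach_arg_pos k v : 0 < k -> v <> 0 -> 0 < v ^ 2 / k ^ 2.
Proof.
  intros Hk Hv. apply Rdiv_lt_0_compat; [now apply pow2_gt_0|].
  apply pow2_gt_0. lra.
Qed.

Lemma radial_arg_pos m k r : 0 < m -> 0 < k -> 0 < r -> 0 < sonic_radius m k / r.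
Proof.
  intros Hm Hk Hr.
  apply Rdiv_lt_0_compat; [now apply sonic_radius_pos|exact Hr].
Qed.

(** The normal form of [G]: logarithms of products split so that the terms
    regroup as [k ^ 2 / 2 * (gap (v ^ 2 / k ^ 2) - 4 * gap (rs / r))]. *)
Lemma G_minus_Gcrit m k r v :
  0 < m -> 0 < k -> 0 < r -> v <> 0 ->
  G m k r v - Gcrit m k = k ^ 2 / 4 * (mach k v ^ 2 - 4 * radial m k r ^ 2).
Proof.
  intros Hm Hk Hr Hv.
  assert (Hrs := sonic_radius_pos m k Hm Hk).
  assert (Hav : 0 < Rabs v) by now apply Rabs_pos_lt.
  unfold mach, radial.
  rewrite !morse_sqr by (now apply mach_arg_pos || now apply radial_arg_pos).
  assert (Em : m = 2 * k ^ 2 * sonic_radius m k).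
  { unfold sonic_radius. field. lra. }
  assert (L1 : ln (r ^ 2 * Rabs v) = 2 * ln r + ln (Rabs v)).
  { replace (r ^ 2) with (r * r) by ring.
    rewrite !ln_mult by (assumption || nra). ring. }
  assert (L2 : ln (m ^ 2 / (4 * k ^ 3)) = 2 * ln (sonic_radius m k) + ln k).
  { replace (m ^ 2 / (4 * k ^ 3)) with (sonic_radius m k * sonic_radius m k * k).
    - rewrite !ln_mult by (assumption || nra). ring.
    - unfold sonic_radius. field. lra. }
  assert (L3 : ln (v ^ 2 / k ^ 2) = 2 * ln (Rabs v) - 2 * ln k).
  { rewrite <- pow2_abs. replace (Rabs v ^ 2 / k ^ 2) with ((Rabs v / k) * (Rabs v / k))
      by (field; lra).
    assert (0 < Rabs v / k) by now apply Rdiv_lt_0_compat.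
    rewrite ln_mult, ln_div by assumption. ring. }
  unfold G, Gcrit, gap. rewrite L1, L2, L3, ln_div by assumption.
  set (rs := sonic_radius m k) in *. rewrite Em. field. lra.
Qed.

Lemma mach_sign k v : 0 < k -> v <> 0 -> sign (mach k v) = sign (Rabs v - k).
Proof.
  intros Hk Hv. unfold mach.
  rewrite sign_morse by now apply mach_arg_pos.
  rewrite <- pow2_abs.
  replace (Rabs v ^ 2 / k ^ 2 - 1)
    with ((Rabs v + k) / k ^ 2 * (Rabs v - k)) by (field; lra).
  rewrite sign_mult, (sign_eq_1 (_ / _)); [ring|].
  apply Rdiv_lt_0_compat; [|nra]. generalize (Rabs_pos v). lra.
Qed.

Lemma radial_decreasing m k r s :
  0 < m -> 0 < k -> 0 < r -> r < s -> radial m k s < radial m k r.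
Proof.
  intros Hm Hk Hr Hs. unfold radial. apply morse_increasing.
  - apply radial_arg_pos; lra.
  - apply Rmult_lt_compat_l; [now apply sonic_radius_pos|].
    apply Rinv_lt_contravar; nra.
Qed.

Lemma radial_sonic m k : 0 < m -> 0 < k -> radial m k (sonic_radius m k) = 0.
Proof.
  intros Hm Hk. assert (H := sonic_radius_pos m k Hm Hk).
  unfold radial. unfold Rdiv. rewrite Rinv_r by lra. apply morse_1.
Qed.

Lemma radius_at_pos m k t : 0 < m -> 0 < k -> 0 < radius_at m k t.
Proof.
  intros Hm Hk. apply Rdiv_lt_0_compat; [now apply sonic_radius_pos|apply unmorse_pos].
Qed.

Lemma radial_radius_at m k t : 0 < m -> 0 < k -> radial m k (radius_at m k t) = t.
Proof.
  intros Hm Hk. assert (H := sonic_radius_pos m k Hm Hk).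
  assert (Hu := unmorse_pos t).
  unfold radial, radius_at.
  replace (sonic_radius m k / (sonic_radius m k / unmorse t)) with (unmorse t)
    by (field; lra).
  apply morse_unmorse.
Qed.

Lemma radial_lt_inv m k r s :
  0 < m -> 0 < k -> 0 < r -> 0 < s -> radial m k s < radial m k r -> r < s.
Proof.
  intros Hm Hk Hr Hs H. destruct (Rtotal_order r s) as [H'|[H'|H']]; [exact H'| |].
  - rewrite H' in H. lra.
  - apply (radial_decreasing m k s r Hm Hk Hs) in H'. lra.
Qed.

Lemma smooth_radial m k r : 0 < m -> 0 < k -> 0 < r -> smooth (radial m k) r.
Proof.
  intros Hm Hk Hr.
  apply (smooth_comp morse (fun s => sonic_radius m k / s)).
  - apply smooth_morse. now apply radial_arg_pos.
  - apply smooth_div; [apply smooth_const|apply smooth_id|lra].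
Qed.

Lemma Derive_radial_neq0 m k r :
  0 < m -> 0 < k -> 0 < r -> Derive (radial m k) r <> 0.
Proof.
  intros Hm Hk Hr. assert (H := radial_arg_pos m k r Hm Hk Hr).
  assert (Hrs := sonic_radius_pos m k Hm Hk).
  unfold radial. rewrite (Derive_comp morse (fun s => sonic_radius m k / s)).
  - assert (Hd := Derive_morse_pos _ H).
    replace (Derive (fun s => sonic_radius m k / s) r) with (- sonic_radius m k / r ^ 2).
    + assert (0 < sonic_radius m k / r ^ 2) by (apply Rdiv_lt_0_compat; nra).
      replace (- sonic_radius m k / r ^ 2) with (- (sonic_radius m k / r ^ 2)) by (field; lra).
      nra.
    + symmetry. apply is_derive_unique. auto_derive; [lra|field; lra].
  - now apply smooth_ex_derive, smooth_morse.
  - auto_derive. lra.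
Qed.

Lemma mach_velocity_at k s w :
  0 < k -> s ^ 2 = 1 -> mach k (velocity_at k s w) = w.
Proof.
  intros Hk Hs. unfold mach, velocity_at.
  rewrite !Rpow_mult_distr, Hs, pow2_sqrt by apply Rlt_le, unmorse_pos.
  replace (1 * k ^ 2 * unmorse w / k ^ 2) with (unmorse w) by (field; lra).
  apply morse_unmorse.
Qed.

Lemma sign_velocity_at k s w : 0 < k -> sign (velocity_at k s w) = sign s.
Proof.
  intros Hk. unfold velocity_at.
  rewrite !sign_mult, (sign_eq_1 k), (sign_eq_1 (sqrt _)); [ring| |exact Hk].
  apply sqrt_lt_R0, unmorse_pos.
Qed.

Lemma velocity_at_neq0 k s w : 0 < k -> s <> 0 -> velocity_at k s w <> 0.
Proof.
  intros Hk Hs H. apply (f_equal sign) in H.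
  rewrite sign_velocity_at, sign_0 in H by exact Hk. now apply (sign_neq_0 s).
Qed.

Lemma sign_sqr v : v <> 0 -> sign v ^ 2 = 1.
Proof.
  intros H. destruct (Rdichotomy _ _ H).
  - rewrite sign_eq_m1 by assumption. ring.
  - rewrite sign_eq_1 by assumption. ring.
Qed.

Lemma sign_abs v : sign v * Rabs v = v.
Proof.
  destruct (Rtotal_order v 0) as [H|[H|H]].
  - rewrite sign_eq_m1, Rabs_left by assumption. ring.
  - rewrite H, Rabs_R0. ring.
  - rewrite sign_eq_1, Rabs_pos_eq by lra. ring.
Qed.

Lemma sign_sign v : sign (sign v) = sign v.
Proof.
  destruct (Rtotal_order v 0) as [H|[H|H]].
  - rewrite (sign_eq_m1 v) by assumption. apply sign_eq_m1. lra.
  - rewrite H, !sign_0. reflexivity.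
  - rewrite (sign_eq_1 v) by assumption. apply sign_eq_1. lra.
Qed.

Lemma velocity_at_mach k v :
  0 < k -> v <> 0 -> velocity_at k (sign v) (mach k v) = v.
Proof.
  intros Hk Hv. unfold velocity_at, mach.
  rewrite unmorse_morse by now apply mach_arg_pos.
  replace (v ^ 2 / k ^ 2) with (Rsqr (Rabs v / k)).
  - rewrite sqrt_Rsqr.
    + transitivity (sign v * Rabs v); [field; lra|apply sign_abs].
    + apply Rdiv_le_0_compat; [apply Rabs_pos|exact Hk].
  - rewrite <- (pow2_abs v). unfold Rsqr. field. lra.
Qed.

Lemma smooth_velocity_at k s W r :
  smooth W r -> smooth (fun x => velocity_at k s (W x)) r.
Proof.
  intros HW. apply smooth_mult; [apply smooth_const|].
  apply (smooth_comp sqrt (fun x => unmorse (W x))).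
  - apply smooth_sqrt, unmorse_pos.
  - apply (smooth_comp unmorse W); [apply smooth_unmorse|exact HW].
Qed.

(** * The Euler equations as conservation of G *)

(** The failure of [v] to satisfy [(1 - k ^ 2 / v ^ 2) v' = (2 k ^ 2 / r -
    m / r ^ 2) / v], the momentum equation after elimination of the density. *)
Definition defect (m k : R) (v : R -> R) (r : R) : R :=
  (1 - k ^ 2 / v r ^ 2) * Derive v r - (2 * k ^ 2 / r - m / r ^ 2) / v r.

(** For constant flux [c] the momentum density is [c * (v + k ^ 2 / v)], from
    which [rho] has disappeared. *)
Lemma momentum_residual m k c (rho v : R -> R) (r : R) :
  0 < r -> locally r (fun s => s ^ 2 * rho s * v s = c) ->
  ex_derive v r -> v r <> 0 ->
  Derive (fun s => s ^ 2 * (v s ^ 2 + k ^ 2) * rho s) r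
    - 2 * k ^ 2 * rho r * r + m * rho r = c * defect m k v r.
Proof.
  intros Hr Hflux Hd Hv.
  assert (Hrho : rho r = c / (r ^ 2 * v r)).
  { rewrite <- (locally_singleton _ _ Hflux). field. lra. }
  assert (Hvl : locally r (fun s : R => v s <> 0)).
  { apply (ex_derive_continuous (K := R_AbsRing) (V := R_NormedModule) v r Hd
      (fun z => z <> 0)).
    now apply locally_neq0. }
  assert (HD : Derive (fun s => s ^ 2 * (v s ^ 2 + k ^ 2) * rho s) r
    = c * (1 - k ^ 2 / v r ^ 2) * Derive v r).
  { apply is_derive_unique.
    apply (is_derive_ext_loc (fun s : R => c * (v s + k ^ 2 / v s))).
    - generalize (filter_and _ _ Hflux Hvl). apply filter_imp.
      intros s [H1 H2].
      change (c * (v s + k ^ 2 / v s) = s ^ 2 * (v s ^ 2 + k ^ 2) * rho s).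
      rewrite <- H1. now field.
    - auto_derive; [tauto|].
      change (Derive (fun x => v x) r) with (Derive v r). field. exact Hv. }
  rewrite HD, Hrho. unfold defect. field. lra.
Qed.

(** Together with [momentum_residual], this identifies the solutions of the
    momentum equation with the curves on which the quadratic form is constant. *)
Lemma is_derive_invariant m k (v : R -> R) (r : R) :
  0 < m -> 0 < k -> 0 < r -> ex_derive v r -> v r <> 0 ->
  is_derive (fun s => mach k (v s) ^ 2 - 4 * radial m k s ^ 2) r
    (4 * v r / k ^ 2 * defect m k v r).
Proof.
  intros Hm Hk Hr Hd Hv.
  assert (Hrs := sonic_radius_pos m k Hm Hk).
  assert (Hvl : locally r (fun s => v s <> 0)).
  { apply (ex_derive_continuous (K := R_AbsRing) (V := R_NormedModule) v r Hd
      (fun z => z <> 0)).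
    now apply locally_neq0. }
  apply is_derive_ext_loc with
    (fun s => 2 * (gap (v s ^ 2 / k ^ 2) - 4 * gap (sonic_radius m k / s))).
  - generalize (filter_and _ _ Hvl (locally_gt 0 r Hr)). apply filter_imp.
    intros s [H1 H2]. unfold mach, radial.
    rewrite !morse_sqr by (now apply mach_arg_pos || now apply radial_arg_pos).
    (* [ring] needs the equation in [R], not in [R] as a normed module *)
    match goal with |- ?x = ?y => change (@eq R x y) end. ring.
  - assert (Hp1 := mach_arg_pos k (v r) Hk Hv).
    assert (Hp2 := radial_arg_pos m k r Hm Hk Hr).
    unfold gap, defect. auto_derive.
    + repeat split; try tauto; try lra; try exact Hp1; exact Hp2.
    + change (fun x => v x) with v. unfold sonic_radius. field. lra.
Qed.

Lemma in_itv_pos a b r : Rbar_le 0 a -> in_itv a b r -> 0 < r.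
Proof. intros Ha [H _]. exact (Rbar_le_lt_trans _ _ _ Ha H). Qed.

Lemma steady_state_flux m k a b rho v r s :
  steady_state m k a b rho v -> in_itv a b r -> in_itv a b s ->
  r ^ 2 * rho r * v r = s ^ 2 * rho s * v s.
Proof.
  intros [_ [Hrho [Hv [Hmass _]]]] Hr Hs.
  apply (constant_on_itv a b (fun x => x ^ 2 * rho x * v x)); [|exact Hr|exact Hs].
  intros z Hz. rewrite <- (Hmass z Hz). apply Derive_correct.
  assert (H1 := Hrho 1%nat z Hz). assert (H2 := Hv 1%nat z Hz). simpl in H1, H2.
  auto_derive. tauto.
Qed.

(** As the flux is not zero, [v] cannot vanish, hence keeps its sign, and
    [momentum_residual] may be divided by the flux. *)
Lemma steady_state_hyperbola m k r0 rho0 v0 a b rho v :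
  0 < m -> 0 < k -> 0 < rho0 -> v0 <> 0 ->
  steady_state_from m k r0 rho0 v0 a b rho v ->
  forall r, in_itv a b r ->
    sign (v r) = sign v0 /\ r ^ 2 * rho r * v r = r0 ^ 2 * rho0 * v0 /\
    mach k (v r) ^ 2 - 4 * radial m k r ^ 2
      = mach k v0 ^ 2 - 4 * radial m k r0 ^ 2.
Proof.
  intros Hm Hk Hrho0 Hv0 [Hss [Hr0 [Er Ev]]] r Hr.
  assert (Hflux : forall s, in_itv a b s -> s ^ 2 * rho s * v s = r0 ^ 2 * rho0 * v0).
  { intros s Hs. rewrite (steady_state_flux _ _ _ _ _ _ s r0 Hss Hs Hr0).
    now rewrite Er, Ev. }
  destruct Hss as [Ha [_ [Hv [_ Hmom]]]].
  assert (Hr0p := in_itv_pos _ _ _ Ha Hr0).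
  assert (Hc : r0 ^ 2 * rho0 * v0 <> 0).
  { apply Rmult_integral_contrapositive_currified; [|exact Hv0].
    assert (0 < r0 ^ 2) by nra. nra. }
  assert (Hvn : forall s, in_itv a b s -> v s <> 0).
  { intros s Hs H0. apply Hc. rewrite <- (Hflux s Hs), H0. ring. }
  assert (Hvd : forall s, in_itv a b s -> ex_derive v s).
  { intros s Hs. exact (Hv 1%nat s Hs). }
  split; [|split].
  - rewrite <- Ev. apply (sign_constant_on_itv a b); try assumption.
    intros z Hz. apply (ex_derive_continuous (K := R_AbsRing) (V := R_NormedModule)).
    now apply Hvd.
  - now apply Hflux.
  - rewrite <- Ev.
    apply (constant_on_itv a b (fun s => mach k (v s) ^ 2 - 4 * radial m k s ^ 2));
      try assumption.
    intros z Hz. assert (Hzp := in_itv_pos _ _ _ Ha Hz).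
    replace 0 with (4 * v z / k ^ 2 * defect m k v z).
    + apply is_derive_invariant; auto.
    + replace (defect m k v z) with 0; [ring|].
      apply Rmult_eq_reg_l with (2 := Hc). rewrite Rmult_0_r, <- (Hmom z Hz).
      apply momentum_residual; auto.
      generalize (in_itv_locally _ _ _ Hz). apply filter_imp. exact Hflux.
Qed.

Lemma steady_state_of_hyperbola m k r0 rho0 v0 a b (v : R -> R) :
  0 < m -> 0 < k -> v0 <> 0 ->
  Rbar_le 0 a -> in_itv a b r0 -> v r0 = v0 ->
  (forall r, in_itv a b r -> smooth v r /\ v r <> 0 /\
     mach k (v r) ^ 2 - 4 * radial m k r ^ 2
       = mach k v0 ^ 2 - 4 * radial m k r0 ^ 2) ->
  steady_state_from m k r0 rho0 v0 a b
    (fun r => r0 ^ 2 * rho0 * v0 / (r ^ 2 * v r)) v.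
Proof.
  intros Hm Hk Hv0 Ha Hr0 Ev Hv.
  assert (Hr0p := in_itv_pos _ _ _ Ha Hr0).
  set (c := r0 ^ 2 * rho0 * v0). set (rho := fun r => c / (r ^ 2 * v r)).
  assert (Hpos : forall r, in_itv a b r -> 0 < r).
  { intros r Hr. exact (in_itv_pos _ _ _ Ha Hr). }
  assert (Hflux : forall r, in_itv a b r ->
    locally r (fun s => s ^ 2 * rho s * v s = c)).
  { intros r Hr. generalize (in_itv_locally _ _ _ Hr). apply filter_imp.
    intros s Hs. unfold rho. field. split; [apply (Hv s Hs)|].
    generalize (Hpos s Hs). lra. }
  split; [split; [exact Ha|split; [|split; [|split]]]|split; [|split]].
  - intros n r Hr. apply smooth_ex_derive_n.
    destruct (Hv r Hr) as [H1 [H2 _]]. generalize (Hpos r Hr); intros H3.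
    apply smooth_div; [apply smooth_const| |].
    + apply smooth_mult; [|exact H1].
      apply smooth_ext_loc with (fun x => x * x);
        [apply filter_forall; intros y; ring|].
      apply smooth_mult; apply smooth_id.
    + apply Rmult_integral_contrapositive_currified; [nra|exact H2].
  - intros n r Hr. apply smooth_ex_derive_n. now apply Hv.
  - intros r Hr. transitivity (Derive (fun _ => c) r); [|apply Derive_const].
    apply Derive_ext_loc. now apply Hflux.
  - intros r Hr. destruct (Hv r Hr) as [H1 [H2 _]].
    rewrite (momentum_residual m k c rho v r); auto; [|now apply smooth_ex_derive].
    replace (defect m k v r) with 0; [ring|].
    assert (H4 : is_derive (fun s => mach k (v s) ^ 2 - 4 * radial m k s ^ 2) r 0).
    { apply is_derive_ext_loc with
        (fun _ => mach k v0 ^ 2 - 4 * radial m k r0 ^ 2).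
      - generalize (in_itv_locally _ _ _ Hr). apply filter_imp.
        intros s Hs. symmetry. now apply Hv.
      - apply @is_derive_const. }
    apply is_derive_unique in H4.
    rewrite (is_derive_unique _ _ _
      (is_derive_invariant m k v r Hm Hk (Hpos r Hr) (smooth_ex_derive _ _ H1) H2)) in H4.
    symmetry. apply Rmult_eq_reg_l with (4 * v r / k ^ 2).
    + rewrite H4. ring.
    + apply Rmult_integral_contrapositive_currified; [lra|].
      apply Rinv_neq_0_compat. nra.
  - exact Hr0.
  - unfold rho, c. rewrite Ev. field. split; [exact Hv0|lra].
  - exact Ev.
Qed.

(** * Branches of the hyperbolas *)

Lemma ex_derive_mach k (v : R -> R) (r : R) :
  0 < k -> ex_derive v r -> v r <> 0 -> ex_derive (fun s => mach k (v s)) r.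
Proof.
  intros Hk Hd Hv. unfold mach.
  apply (ex_derive_comp morse (fun s => v s ^ 2 / k ^ 2)).
  - now apply smooth_ex_derive, smooth_morse, mach_arg_pos.
  - auto_derive. exact Hd.
Qed.

(** Reduces the initial value problem to one in the phase plane: it is enough
    to find a smooth branch [W] of the hyperbola through the initial point, of
    which every differentiable branch through that point is a restriction. *)
Lemma unique_steady_state_of_branch m k r0 rho0 v0 a b (W : R -> R) :
  0 < m -> 0 < k -> 0 < rho0 -> v0 <> 0 ->
  Rbar_le 0 a -> in_itv a b r0 -> W r0 = mach k v0 ->
  (forall r, in_itv a b r -> smooth W r /\
     W r ^ 2 - 4 * radial m k r ^ 2 = mach k v0 ^ 2 - 4 * radial m k r0 ^ 2) ->
  (forall a' b' (w : R -> R), Rbar_le 0 a' -> in_itv a' b' r0 -> w r0 = mach k v0 ->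
     (forall r, in_itv a' b' r -> ex_derive w r /\
        w r ^ 2 - 4 * radial m k r ^ 2 = mach k v0 ^ 2 - 4 * radial m k r0 ^ 2) ->
     forall r, in_itv a' b' r -> in_itv a b r /\ w r = W r) ->
  exists rho, unique_steady_state_from m k r0 rho0 v0 a b rho
    (fun r => velocity_at k (sign v0) (W r)).
Proof.
  intros Hm Hk Hrho0 Hv0 Ha Hr0 HW0 HW Huniq.
  set (v := fun r => velocity_at k (sign v0) (W r)).
  assert (Hs : sign v0 <> 0) by now apply sign_neq_0.
  exists (fun r => r0 ^ 2 * rho0 * v0 / (r ^ 2 * v r)). split.
  - apply steady_state_of_hyperbola; try assumption.
    + unfold v. rewrite HW0. now apply velocity_at_mach.
    + intros r Hr. destruct (HW r Hr) as [H1 H2]. unfold v. split; [|split].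
      * now apply smooth_velocity_at.
      * now apply velocity_at_neq0.
      * rewrite mach_velocity_at; [exact H2|exact Hk|now apply sign_sqr].
  - intros a' b' rho' v' H' r Hr.
    assert (Hyp := steady_state_hyperbola _ _ _ _ _ _ _ _ _ Hm Hk Hrho0 Hv0 H').
    destruct H' as [[Ha' [_ [Hv' _]]] [Hr0' [_ Ev']]].
    assert (Hn : forall s, in_itv a' b' s -> v' s <> 0).
    { intros s Hs' H0. destruct (Hyp s Hs') as [Hsg _].
      rewrite H0, sign_0 in Hsg. now apply Hs. }
    destruct (Huniq a' b' (fun s => mach k (v' s)) Ha' Hr0') with (r := r) as [Hin Hw].
    + now rewrite Ev'.
    + intros s Hs'. split; [|now apply Hyp].
      apply ex_derive_mach; [exact Hk|exact (Hv' 1%nat s Hs')|now apply Hn].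
    + exact Hr.
    + destruct (Hyp r Hr) as [Hsg [Hfl _]].
      assert (Ev : v' r = v r).
      { unfold v. rewrite <- Hw, <- Hsg. symmetry.
        apply velocity_at_mach; [exact Hk|now apply Hn]. }
      split; [exact Hin|split; [|exact Ev]].
      rewrite <- Hfl, Ev. assert (Hrp := in_itv_pos _ _ _ Ha Hin).
      assert (v r <> 0) by (rewrite <- Ev; now apply Hn).
      field. split; [assumption|lra].
Qed.

(** A continuous square root of a positive function cannot change sign. *)
Lemma root_branch a b (w F : R -> R) (r0 r : R) :
  (forall z, in_itv a b z -> continuous w z /\ w z ^ 2 = F z /\ 0 < F z) ->
  in_itv a b r0 -> in_itv a b r -> w r = sign (w r0) * sqrt (F r).
Proof.
  intros H Hr0 Hr.
  rewrite (sign_constant_on_itv a b w r0 r); try assumption.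
  - destruct (H r Hr) as [_ [<- _]].
    rewrite <- Rsqr_pow2, sqrt_Rsqr_abs. symmetry. apply sign_abs.
  - intros z Hz. now apply H.
  - intros z Hz H0. destruct (H z Hz) as [_ [H1 H2]]. rewrite H0 in H1. lra.
Qed.

(** The difference quotient of [f] at a zero [c] of [f], completed by the
    derivative at [c]. *)
Definition slope (f : R -> R) (c z : R) : R :=
  if Req_EM_T z c then Derive f c else f z / (z - c).

Lemma slope_at (f : R -> R) c : slope f c c = Derive f c.
Proof. unfold slope. destruct (Req_EM_T c c); [reflexivity|tauto]. Qed.

Lemma slope_off (f : R -> R) c z : z <> c -> slope f c z = f z / (z - c).
Proof. intros H. unfold slope. destruct (Req_EM_T z c); [tauto|reflexivity]. Qed.

Lemma locally_neq (c x : R) : x <> c -> locally x (fun y : R => y <> c).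
Proof.
  intros H. assert (Hc : continuous (fun y : R => y - c) x).
  { apply (continuous_minus (fun y : R => y) (fun _ => c));
      [apply continuous_id|apply continuous_const]. }
  assert (Hx : x - c <> 0) by lra.
  generalize (Hc _ (locally_neq0 _ Hx)). unfold filtermap.
  apply filter_imp. intros y Hy E. apply Hy. rewrite E. apply Rminus_diag.
Qed.

Lemma continuous_slope (f : R -> R) (c z : R) :
  (z = c -> f c = 0) -> ex_derive f z -> continuous (slope f c) z.
Proof.
  intros Hfc Hd. destruct (Req_EM_T z c) as [->|Hz].
  - specialize (Hfc eq_refl). apply continuity_pt_filterlim, continuity_pt_locally. intros eps.
    destruct Hd as [l Hl]. assert (El := is_derive_unique _ _ _ Hl).
    apply is_derive_Reals in Hl.
    destruct (Hl eps (cond_pos eps)) as [d Hd].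
    cut (forall y : R, Rabs (y - c) < d -> Rabs (slope f c y - slope f c c) < eps).
    { intros H. exists d. exact H. }
    intros y Hy.
    rewrite slope_at, El. destruct (Req_EM_T y c) as [->|Hyc].
    + rewrite slope_at, El, Rminus_diag, Rabs_R0. apply cond_pos.
    + rewrite slope_off by exact Hyc.
      specialize (Hd (y - c) ltac:(lra) Hy).
      replace (c + (y - c)) with y in Hd by ring.
      now rewrite Hfc, Rminus_0_r in Hd.
  - apply (continuous_ext_loc _ (fun y : R => f y / (y - c))).
    + generalize (locally_neq c z Hz). apply filter_imp.
      intros y Hy. symmetry. now apply slope_off.
    + apply (ex_derive_continuous (K := R_AbsRing) (V := R_NormedModule)
        (fun y => f y / (y - c)) z).
      auto_derive. split; [exact Hd|]. split; [|exact I]. lra.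
Qed.

Lemma locally_punctured (c : R) (P : R -> Prop) :
  locally c P -> exists z, z <> c /\ P z.
Proof.
  intros [d Hd]. assert (H := cond_pos d). exists (c + d / 2).
  split; [lra|]. apply Hd. change (Rabs (c + d / 2 - c) < d).
  rewrite Rabs_pos_eq; lra.
Qed.

Lemma in_itv_neighbours a b r :
  in_itv a b r -> exists p q, in_itv a b p /\ in_itv a b q /\ p < r < q.
Proof.
  intros Hr. destruct (in_itv_locally _ _ _ Hr) as [d Hd].
  assert (H := cond_pos d). exists (r - d / 2), (r + d / 2).
  split; [|split; [|lra]]; apply Hd.
  - change (Rabs (r - d / 2 - r) < d). rewrite Rabs_left; lra.
  - change (Rabs (r + d / 2 - r) < d). rewrite Rabs_pos_eq; lra.
Qed.

(** Both [w] and [radial] vanish at the sonic radius, where the equation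
    [w ^ 2 = 4 * radial ^ 2] does not prevent [w] from switching between the two
    lines.  Differentiability does: as [radial] has a nonzero derivative, the
    quotient [w / radial] extends continuously over the sonic radius, and a
    continuous function on an interval whose square is 4 is constant. *)
Lemma critical_branch m k a b (w : R -> R) r0 :
  0 < m -> 0 < k -> Rbar_le 0 a -> in_itv a b r0 ->
  (forall r, in_itv a b r -> ex_derive w r /\ w r ^ 2 = 4 * radial m k r ^ 2) ->
  exists eta, (eta = 1 \/ eta = -1) /\
    forall r, in_itv a b r -> w r = 2 * eta * radial m k r.
Proof.
  intros Hm Hk Ha Hr0 Hw. set (c := sonic_radius m k).
  assert (Hcp : 0 < c) by now apply sonic_radius_pos.
  assert (Hpos : forall r, in_itv a b r -> 0 < r).
  { intros r Hr. exact (in_itv_pos _ _ _ Ha Hr). }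
  assert (Hsc : radial m k c = 0) by now apply radial_sonic.
  assert (Hsd : forall r, 0 < r -> ex_derive (radial m k) r).
  { intros r Hr. now apply smooth_ex_derive, smooth_radial. }
  assert (Hs0 : forall r, 0 < r -> r <> c -> radial m k r <> 0).
  { intros r Hr Hrc. destruct (Rdichotomy _ _ Hrc) as [H|H].
    - generalize (radial_decreasing m k r c Hm Hk Hr H). lra.
    - generalize (radial_decreasing m k c r Hm Hk Hcp H). lra. }
  (* [w / radial] off the sonic radius, the ratio of the derivatives there *)
  set (q := fun r => slope w c r / slope (radial m k) c r).
  assert (Hslope : forall r, 0 < r -> slope (radial m k) c r <> 0).
  { intros r Hr. destruct (Req_EM_T r c) as [->|Hrc].
    - rewrite slope_at. now apply Derive_radial_neq0.
    - rewrite slope_off by exact Hrc.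
      apply Rmult_integral_contrapositive_currified; [now apply Hs0|].
      apply Rinv_neq_0_compat. lra. }
  assert (Hwc : in_itv a b c -> w c = 0).
  { intros H. destruct (Hw c H) as [_ H2]. rewrite Hsc in H2. nra. }
  assert (Hqc : forall r, in_itv a b r -> continuous q r).
  { intros r Hr. apply (continuous_mult (slope w c) (fun z => / slope (radial m k) c z)).
    - apply continuous_slope; [|now apply Hw]. intros E. apply Hwc. now rewrite <- E.
    - apply continuous_Rinv_comp.
      + apply continuous_slope; [intros _; exact Hsc|]. now apply Hsd, Hpos.
      + now apply Hslope, Hpos. }
  assert (Hqoff : forall r, in_itv a b r -> r <> c -> q r = w r / radial m k r).
  { intros r Hr Hrc. unfold q. rewrite !slope_off by exact Hrc.
    field. split; [|lra]. apply Hs0; [now apply Hpos|exact Hrc]. }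
  assert (Hq2off : forall r, in_itv a b r -> r <> c -> q r ^ 2 = 4).
  { intros r Hr Hrc. rewrite Hqoff by assumption.
    replace ((w r / radial m k r) ^ 2) with (w r ^ 2 / radial m k r ^ 2)
      by (field; apply Hs0; [now apply Hpos|exact Hrc]).
    destruct (Hw r Hr) as [_ ->]. field. apply Hs0; [now apply Hpos|exact Hrc]. }
  assert (Hq2 : forall r, in_itv a b r -> q r ^ 2 = 4).
  { intros r Hr. destruct (Req_EM_T r c) as [E|Hrc]; [|now apply Hq2off].
    destruct (Req_EM_T (q r ^ 2) 4) as [H4|H4]; [exact H4|exfalso].
    assert (Hc2 : continuous (fun z => q z ^ 2) r).
    { apply (continuous_ext (fun z => q z * q z)); [intros z; simpl; ring|].
      apply (continuous_mult q q); now apply Hqc. }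
    assert (Hl := Hc2 _ (locally_neq 4 _ H4)). unfold filtermap in Hl.
    destruct (locally_punctured r _
      (filter_and _ _ Hl (in_itv_locally _ _ _ Hr))) as [z [Hz [H1 H2]]].
    apply H1. apply Hq2off; [exact H2|]. now rewrite <- E. }
  exists (q r0 / 2). split.
  - assert (H : (q r0 - 2) * (q r0 + 2) = 0).
    { generalize (Hq2 r0 Hr0). nra. }
    apply Rmult_integral in H. destruct H; [left|right]; lra.
  - intros r Hr.
    assert (Hqr : q r = q r0).
    { assert (Hrt : forall z, in_itv a b z -> q z = sign (q r0) * sqrt 4).
      { intros z Hz. apply (root_branch a b q (fun _ => 4)); try assumption.
        intros x Hx. split; [now apply Hqc|split; [now apply Hq2|lra]]. }
      now rewrite (Hrt r Hr), <- (Hrt r0 Hr0). }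
    rewrite <- Hqr. destruct (Req_EM_T r c) as [E|Hrc].
    + rewrite E in Hr |- *. rewrite (Hwc Hr), Hsc. ring.
    + rewrite Hqoff by assumption. field. apply Hs0; [now apply Hpos|exact Hrc].
Qed.

(** * The critical curves *)

Lemma Scrit_mach m k r v :
  0 < m -> 0 < k -> 0 < r -> v <> 0 ->
  Scrit m k r v = k ^ 2 / 4 * (mach k v ^ 2 - 4 * radial m k r ^ 2).
Proof.
  intros Hm Hk Hr Hv. rewrite <- G_minus_Gcrit by assumption.
  unfold Scrit, G, Gcrit. ring.
Qed.

(** On the positive half-line, [Scrit] prescribes [mach k x ^ 2], and the side
    of [k] prescribes the sign of [mach k x]. *)
Lemma Scrit_root_unique m k r x y :
  0 < m -> 0 < k -> 0 < r -> 0 < x -> 0 < y -> 0 < (x - k) * (y - k) ->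
  Scrit m k r x = 0 -> Scrit m k r y = 0 -> x = y.
Proof.
  intros Hm Hk Hr Hx Hy Hside Sx Sy.
  rewrite Scrit_mach in Sx, Sy by (assumption || lra).
  assert (Hk2 : 0 < k ^ 2 / 4) by nra.
  assert (E : mach k x ^ 2 = mach k y ^ 2) by nra.
  assert (Esg : sign (mach k x) = sign (mach k y)).
  { rewrite !mach_sign, !Rabs_pos_eq by lra.
    destruct (Rlt_or_le x k).
    - rewrite !sign_eq_m1 by nra. reflexivity.
    - rewrite !sign_eq_1 by nra. reflexivity. }
  assert (E' : mach k x = mach k y).
  { rewrite <- (sign_abs (mach k x)), <- (sign_abs (mach k y)), Esg. f_equal.
    apply Rsqr_eq_abs_0. now rewrite !Rsqr_pow2. }
  rewrite <- (velocity_at_mach k x), <- (velocity_at_mach k y), E' by lra.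
  now rewrite (sign_eq_1 x), (sign_eq_1 y).
Qed.

Lemma v1_eq m k r x :
  0 < m -> 0 < k -> 0 < r -> 0 < x < k -> Scrit m k r x = 0 -> v1 m k r = x.
Proof.
  intros Hm Hk Hr Hx HS.
  apply (iota_unique (V := R_CompleteNormedModule)); [|now split].
  intros y [Hy HSy]. apply (Scrit_root_unique m k r); try assumption; try lra. nra.
Qed.

Lemma v2_eq m k r x :
  0 < m -> 0 < k -> 0 < r -> k < x -> Scrit m k r x = 0 -> v2 m k r = x.
Proof.
  intros Hm Hk Hr Hx HS.
  apply (iota_unique (V := R_CompleteNormedModule)); [|now split].
  intros y [Hy HSy]. apply (Scrit_root_unique m k r); try assumption; try lra. nra.
Qed.

Lemma v_N_flat_opp m k r : v_N_flat m k r = - v_P_flat m k r.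
Proof.
  unfold v_N_flat, v_P_flat, glue, v3, v4.
  destruct (Rlt_dec _ _); [|destruct (Rlt_dec _ _)]; reflexivity.
Qed.

Lemma v_N_sharp_opp m k r : v_N_sharp m k r = - v_P_sharp m k r.
Proof.
  unfold v_N_sharp, v_P_sharp, glue, v3, v4.
  destruct (Rlt_dec _ _); [|destruct (Rlt_dec _ _)]; reflexivity.
Qed.

Lemma mach_Rabs k v : mach k (Rabs v) = mach k v.
Proof. unfold mach. now rewrite pow2_abs. Qed.

(** As [radial] is positive before the sonic radius and negative after it, the
    line [W = 2 * sigma] is supersonic and then subsonic, which is the sharp
    curve; the opposite line is the flat one. *)
Lemma Rabs_critical m k r v eta :
  0 < m -> 0 < k -> 0 < r -> v <> 0 -> eta = 1 \/ eta = -1 ->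
  mach k v = 2 * eta * radial m k r ->
  Rabs v = if Req_EM_T eta 1 then v_P_sharp m k r else v_P_flat m k r.
Proof.
  intros Hm Hk Hr Hv Heta Hmach.
  assert (Hc := sonic_radius_pos m k Hm Hk).
  assert (Hc0 := radial_sonic m k Hm Hk).
  assert (Hx : 0 < Rabs v) by now apply Rabs_pos_lt.
  assert (HS : Scrit m k r (Rabs v) = 0).
  { rewrite Scrit_mach, mach_Rabs, Hmach by (assumption || lra).
    destruct Heta as [-> | ->]; ring. }
  assert (Hsg : sign (2 * eta * radial m k r) = sign (Rabs v - k)).
  { rewrite <- Hmach. now apply mach_sign. }
  assert (Hlt : 2 * eta * radial m k r < 0 -> Rabs v < k).
  { intros H. rewrite (sign_eq_m1 _ H) in Hsg.
    destruct (Rtotal_order (Rabs v) k) as [H'|[H'|H']]; [exact H'| |].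
    - rewrite H', Rminus_diag, sign_0 in Hsg. lra.
    - rewrite sign_eq_1 in Hsg by lra. lra. }
  assert (Hgt : 0 < 2 * eta * radial m k r -> k < Rabs v).
  { intros H. rewrite (sign_eq_1 _ H) in Hsg.
    destruct (Rtotal_order (Rabs v) k) as [H'|[H'|H']]; [| |exact H'].
    - rewrite sign_eq_m1 in Hsg by lra. lra.
    - rewrite H', Rminus_diag, sign_0 in Hsg. lra. }
  assert (Heq : 2 * eta * radial m k r = 0 -> Rabs v = k).
  { intros H. rewrite H, sign_0 in Hsg.
    destruct (Rtotal_order (Rabs v) k) as [H'|[H'|H']]; [|exact H'|].
    - rewrite sign_eq_m1 in Hsg by lra. lra.
    - rewrite sign_eq_1 in Hsg by lra. lra. }
  unfold v_P_sharp, v_P_flat, glue.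
  destruct (Req_EM_T eta 1) as [He|He];
    [|assert (He' : eta = -1) by (destruct Heta; tauto)];
    (destruct (Rlt_dec r (sonic_radius m k)) as [H1|H1];
     [assert (H3 := radial_decreasing m k r (sonic_radius m k) Hm Hk Hr H1)
     |destruct (Rlt_dec (sonic_radius m k) r) as [H2|H2];
      [assert (H3 := radial_decreasing m k (sonic_radius m k) r Hm Hk Hc H2)
      |assert (H3 : r = sonic_radius m k) by lra]]).
  - symmetry. apply v2_eq; try assumption. apply Hgt. nra.
  - symmetry. apply v1_eq; try assumption. split; [exact Hx|]. apply Hlt. nra.
  - apply Heq. rewrite H3, Hc0. ring.
  - symmetry. apply v1_eq; try assumption. split; [exact Hx|]. apply Hlt. nra.
  - symmetry. apply v2_eq; try assumption. apply Hgt. nra.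
  - apply Heq. rewrite H3, Hc0. ring.
Qed.

Lemma critical_is_curve m k v0 a b (v : R -> R) eta :
  0 < m -> 0 < k -> Rbar_le 0 a -> v0 <> 0 -> eta = 1 \/ eta = -1 ->
  (forall r, in_itv a b r ->
     sign (v r) = sign v0 /\ mach k (v r) = 2 * eta * radial m k r) ->
  critical_on m k a b v /\ is_critical_curve_on m k a b v.
Proof.
  intros Hm Hk Ha Hv0 Heta Hv.
  assert (Hn : forall r, in_itv a b r -> v r <> 0).
  { intros r Hr H0. destruct (Hv r Hr) as [H _]. rewrite H0, sign_0 in H.
    now apply (sign_neq_0 v0). }
  split.
  - intros r Hr. assert (Hrp := in_itv_pos _ _ _ Ha Hr).
    rewrite Scrit_mach by auto. destruct (Hv r Hr) as [_ ->].
    destruct Heta as [-> | ->]; ring.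
  - assert (Habs : forall r, in_itv a b r -> v r = sign v0 *
      (if Req_EM_T eta 1 then v_P_sharp m k r else v_P_flat m k r)).
    { intros r Hr. assert (Hrp := in_itv_pos _ _ _ Ha Hr).
      destruct (Hv r Hr) as [H1 H2].
      rewrite <- (Rabs_critical m k r (v r) eta), <- H1 by auto.
      symmetry. apply sign_abs. }
    unfold is_critical_curve_on, agree_on.
    destruct (Req_EM_T eta 1) as [He|He]; destruct (Rdichotomy _ _ Hv0) as [H|H].
    + right; right; right. intros r Hr.
      rewrite (Habs r Hr), v_N_sharp_opp, sign_eq_m1 by exact H. ring.
    + right; left. intros r Hr. rewrite (Habs r Hr), sign_eq_1 by exact H. ring.
    + right; right; left. intros r Hr.
      rewrite (Habs r Hr), v_N_flat_opp, sign_eq_m1 by exact H. ring.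
    + left. intros r Hr. rewrite (Habs r Hr), sign_eq_1 by exact H. ring.
Qed.

(** * Solutions for each level of G *)

Lemma velocity_at_sonic_side k v0 w :
  0 < k -> v0 <> 0 ->
  sign (Rabs (velocity_at k (sign v0) w) - k) = sign w.
Proof.
  intros Hk Hv0. rewrite <- mach_sign.
  - rewrite mach_velocity_at; [reflexivity|exact Hk|now apply sign_sqr].
  - exact Hk.
  - apply velocity_at_neq0; [exact Hk|now apply sign_neq_0].
Qed.

(** The cases [e > 0] and [e < 0] differ only in the set where
    [e + 4 * sigma ^ 2] is positive.  The last hypothesis says that an interval
    containing [r0] on which it is nonnegative stays inside (a, b): this makes
    the branch maximal. *)
Lemma noncritical_solution m k r0 rho0 v0 a b :
  0 < m -> 0 < k -> 0 < rho0 -> v0 <> 0 -> Rbar_le 0 a -> in_itv a b r0 ->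
  let F := fun r => mach k v0 ^ 2 - 4 * radial m k r0 ^ 2 + 4 * radial m k r ^ 2 in
  (forall r, in_itv a b r -> 0 < F r) ->
  (forall a' b', Rbar_le 0 a' -> in_itv a' b' r0 ->
     (forall r, in_itv a' b' r -> 0 <= F r) ->
     forall r, in_itv a' b' r -> in_itv a b r) ->
  exists rho v, unique_steady_state_from m k r0 rho0 v0 a b rho v /\
    forall r, in_itv a b r ->
      sign (v r) = sign v0 /\ sign (Rabs (v r) - k) = sign (Rabs v0 - k).
Proof.
  intros Hm Hk Hrho0 Hv0 Ha Hr0 F HF Hmax.
  set (W := fun r => sign (mach k v0) * sqrt (F r)).
  assert (HF0 : F r0 = mach k v0 ^ 2) by (unfold F; ring).
  assert (HM : mach k v0 <> 0).
  { intros H. generalize (HF r0 Hr0). rewrite HF0, H. lra. }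
  destruct (unique_steady_state_of_branch m k r0 rho0 v0 a b W) as [rho Hrho];
    try assumption.
  - unfold W. rewrite HF0, <- Rsqr_pow2, sqrt_Rsqr_abs. apply sign_abs.
  - intros r Hr. assert (Hrp := in_itv_pos _ _ _ Ha Hr). split.
    + apply smooth_mult; [apply smooth_const|].
      apply (smooth_comp sqrt F); [now apply smooth_sqrt, HF|].
      apply smooth_plus; [apply smooth_const|].
      apply smooth_mult; [apply smooth_const|].
      apply smooth_mult; [now apply smooth_radial|].
      apply smooth_mult; [now apply smooth_radial|apply smooth_const].
    + unfold W. rewrite Rpow_mult_distr, sign_sqr, pow2_sqrt by
        (exact HM || now apply Rlt_le, HF).
      unfold F. ring.
  - intros a' b' w Ha' Hr0' Hw0 Hw.
    assert (HwF : forall r, in_itv a' b' r -> w r ^ 2 = F r).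
    { intros r Hr. unfold F. destruct (Hw r Hr) as [_ <-]. ring. }
    assert (Hin : forall r, in_itv a' b' r -> in_itv a b r).
    { apply (Hmax a' b' Ha' Hr0'). intros r Hr. rewrite <- HwF by exact Hr.
      apply pow2_ge_0. }
    intros r Hr. split; [now apply Hin|]. unfold W. rewrite <- Hw0.
    apply (root_branch a' b'); try assumption.
    intros z Hz. split; [|split; [now apply HwF|now apply HF, Hin]].
    apply (ex_derive_continuous (K := R_AbsRing) (V := R_NormedModule)). now apply Hw.
  - exists rho, (fun r => velocity_at k (sign v0) (W r)). split; [exact Hrho|].
    intros r Hr. split.
    + rewrite sign_velocity_at by exact Hk. apply sign_sign.
    + rewrite velocity_at_sonic_side by assumption.
      rewrite <- mach_sign by assumption. unfold W.
      rewrite sign_mult, sign_sign, (sign_eq_1 (sqrt _)); [ring|].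
      now apply sqrt_lt_R0, HF.
Qed.

Lemma supercritical_solution m k r0 rho0 v0 :
  0 < m -> 0 < k -> 0 < r0 -> 0 < rho0 -> v0 <> 0 -> Gcrit m k < G m k r0 v0 ->
  exists rho v, unique_steady_state_from m k r0 rho0 v0 0 p_infty rho v /\
    forall r, in_itv 0 p_infty r ->
      sign (v r) = sign v0 /\ sign (Rabs (v r) - k) = sign (Rabs v0 - k).
Proof.
  intros Hm Hk Hr0 Hrho0 Hv0 HG.
  assert (HG' := G_minus_Gcrit m k r0 v0 Hm Hk Hr0 Hv0).
  apply noncritical_solution; try assumption.
  - apply Rle_refl.
  - now split.
  - intros r _. generalize (pow2_ge_0 (radial m k r)). intros H.
    assert (0 < k ^ 2 / 4) by nra. nra.
  - intros a' b' Ha' _ _ r Hr. split; [|exact I].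
    exact (in_itv_pos _ _ _ Ha' Hr).
Qed.

(** On an interval that avoids the band [|sigma| < d], [sigma] cannot jump from
    one side of the band to the other. *)
Lemma radial_barrier m k d a b r0 r :
  0 < m -> 0 < k -> Rbar_le 0 a -> 0 < d ->
  (forall z, in_itv a b z -> d ^ 2 <= radial m k z ^ 2) ->
  in_itv a b r0 -> in_itv a b r ->
  (0 < radial m k r0 -> d < radial m k r) /\ (radial m k r0 < 0 -> radial m k r < - d).
Proof.
  intros Hm Hk Ha Hd H Hr0 Hr.
  assert (Hsg : forall z, in_itv a b z -> sign (radial m k z) = sign (radial m k r0)).
  { intros z Hz. apply (sign_constant_on_itv a b); try assumption.
    - intros x Hx. apply smooth_continuous, smooth_radial; try assumption.
      exact (in_itv_pos _ _ _ Ha Hx).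
    - intros x Hx H0. specialize (H x Hx). rewrite H0 in H. nra. }
  (* the bound is strict because the interval is open *)
  destruct (in_itv_neighbours _ _ _ Hr) as [p [q [Hp [Hq Hpq]]]].
  assert (Hpp := in_itv_pos _ _ _ Ha Hp). assert (Hrp := in_itv_pos _ _ _ Ha Hr).
  assert (D1 := radial_decreasing m k p r Hm Hk Hpp ltac:(lra)).
  assert (D2 := radial_decreasing m k r q Hm Hk Hrp ltac:(lra)).
  split; intros H0.
  - assert (Hs := Hsg q Hq). rewrite (sign_eq_1 _ H0) in Hs.
    assert (0 < radial m k q).
    { destruct (Rtotal_order (radial m k q) 0) as [H'|[H'|H']]; [| |exact H'].
      - rewrite sign_eq_m1 in Hs by exact H'. lra.
      - rewrite H', sign_0 in Hs. lra. }
    specialize (H q Hq). nra.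
  - assert (Hs := Hsg p Hp). rewrite (sign_eq_m1 _ H0) in Hs.
    assert (radial m k p < 0).
    { destruct (Rtotal_order (radial m k p) 0) as [H'|[H'|H']]; [exact H'| |].
      - rewrite H', sign_0 in Hs. lra.
      - rewrite sign_eq_1 in Hs by exact H'. lra. }
    specialize (H p Hp). nra.
Qed.

Lemma subcritical_solution m k r0 rho0 v0 :
  0 < m -> 0 < k -> 0 < r0 -> 0 < rho0 -> v0 <> 0 -> G m k r0 v0 < Gcrit m k ->
  Rabs v0 <> k ->
  exists a b rho v lo hi, unique_steady_state_from m k r0 rho0 v0 a b rho v /\
    (forall r, in_itv a b r ->
      sign (v r) = sign v0 /\ sign (Rabs (v r) - k) = sign (Rabs v0 - k)) /\
    0 < lo /\ lo < sonic_radius m k /\ sonic_radius m k < hi /\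
    G m k lo k = G m k r0 v0 /\ G m k hi k = G m k r0 v0 /\
    (r0 < sonic_radius m k -> a = Finite 0 /\ b = Finite lo) /\
    (sonic_radius m k < r0 -> a = Finite hi /\ b = p_infty).
Proof.
  intros Hm Hk Hr0 Hrho0 Hv0 HG Hside.
  assert (HG' := G_minus_Gcrit m k r0 v0 Hm Hk Hr0 Hv0).
  assert (Hc := sonic_radius_pos m k Hm Hk).
  assert (Hc0 := radial_sonic m k Hm Hk).
  assert (Hk2 : 0 < k ^ 2 / 4) by nra.
  assert (HM : 0 < mach k v0 ^ 2).
  { apply pow2_gt_0. intros H. apply (f_equal sign) in H.
    rewrite sign_0, mach_sign in H by assumption.
    apply (sign_neq_0 (Rabs v0 - k)); [lra|exact H]. }
  set (e := mach k v0 ^ 2 - 4 * radial m k r0 ^ 2) in *.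
  assert (He : e < 0) by nra.
  set (d := sqrt (- e / 4)).
  assert (Hd : 0 < d) by (apply sqrt_lt_R0; lra).
  assert (Hd2 : d ^ 2 = - e / 4) by (apply pow2_sqrt; lra).
  set (lo := radius_at m k d). set (hi := radius_at m k (- d)).
  assert (Hlo : 0 < lo) by now apply radius_at_pos.
  assert (Hhi : 0 < hi) by now apply radius_at_pos.
  assert (Rlo : radial m k lo = d) by now apply radial_radius_at.
  assert (Rhi : radial m k hi = - d) by now apply radial_radius_at.
  assert (Hloc : lo < sonic_radius m k).
  { apply (radial_lt_inv m k); try assumption. lra. }
  assert (Hchi : sonic_radius m k < hi).
  { apply (radial_lt_inv m k); try assumption. lra. }
  assert (HGk : forall r, 0 < r -> radial m k r ^ 2 = d ^ 2 ->
    G m k r k = G m k r0 v0).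
  { intros r Hr H. assert (H' := G_minus_Gcrit m k r k Hm Hk Hr ltac:(lra)).
    assert (Hmk : mach k k = 0).
    { unfold mach. replace (k ^ 2 / k ^ 2) with 1 by (field; lra). apply morse_1. }
    rewrite Hmk, H, Hd2 in H'. nra. }
  assert (Hr02 : d ^ 2 < radial m k r0 ^ 2) by (unfold e in Hd2; lra).
  assert (Hr0c : r0 <> sonic_radius m k).
  { intros H. rewrite H, Hc0 in Hr02. nra. }
  assert (Hfin : exists a b, Rbar_le 0 a /\ in_itv a b r0 /\
    (forall r, in_itv a b r -> 0 < e + 4 * radial m k r ^ 2) /\
    (forall a' b', Rbar_le 0 a' -> in_itv a' b' r0 ->
      (forall r, in_itv a' b' r -> 0 <= e + 4 * radial m k r ^ 2) ->
      forall r, in_itv a' b' r -> in_itv a b r) /\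
    (r0 < sonic_radius m k -> a = Finite 0 /\ b = Finite lo) /\
    (sonic_radius m k < r0 -> a = Finite hi /\ b = p_infty)).
  { destruct (Rdichotomy _ _ Hr0c) as [H|H].
    - exists (Finite 0), (Finite lo).
      assert (Hr0s : 0 < radial m k r0).
      { rewrite <- Hc0. now apply radial_decreasing. }
      split; [apply Rle_refl|]. split; [|split; [|split; [|split]]].
      + split; [exact Hr0|]. simpl. apply (radial_lt_inv m k); try assumption. nra.
      + intros r [H1 H2]. simpl in H1, H2.
        assert (H3 := radial_decreasing m k r lo Hm Hk H1 H2). nra.
      + intros a' b' Ha' Hr0' HF r Hr. assert (Hrp := in_itv_pos _ _ _ Ha' Hr).
        split; [exact Hrp|]. simpl. apply (radial_lt_inv m k); try assumption.
        rewrite Rlo. apply (radial_barrier m k d a' b' r0); try assumption.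
        intros z Hz. specialize (HF z Hz). lra.
      + now split.
      + lra.
    - exists (Finite hi), p_infty.
      assert (Hr0s : radial m k r0 < 0).
      { rewrite <- Hc0. now apply radial_decreasing. }
      split; [simpl; lra|]. split; [|split; [|split; [|split]]].
      + split; [|exact I]. simpl. apply (radial_lt_inv m k); try assumption. nra.
      + intros r [H1 _]. simpl in H1.
        assert (H3 := radial_decreasing m k hi r Hm Hk Hhi H1). nra.
      + intros a' b' Ha' Hr0' HF r Hr. assert (Hrp := in_itv_pos _ _ _ Ha' Hr).
        split; [|exact I]. simpl. apply (radial_lt_inv m k); try assumption.
        rewrite Rhi. apply (radial_barrier m k d a' b' r0); try assumption.
        intros z Hz. specialize (HF z Hz). lra.
      + lra.
      + now split. }
  destruct Hfin as [a [b [Ha [Hin [HF [Hmax [Hab1 Hab2]]]]]]].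
  destruct (noncritical_solution m k r0 rho0 v0 a b) as [rho [v [H1 H2]]];
    try assumption.
  exists a, b, rho, v, lo, hi.
  repeat (split; [assumption|]).
  split; [apply HGk; [assumption|now rewrite Rlo]|].
  split; [apply HGk; [assumption|rewrite Rhi; ring]|]. now split.
Qed.

Lemma smooth_critical_branch m k eta r :
  0 < m -> 0 < k -> 0 < r -> smooth (fun s => 2 * eta * radial m k s) r.
Proof.
  intros Hm Hk Hr. apply smooth_mult; [apply smooth_const|now apply smooth_radial].
Qed.

(** The initial point lies on exactly one of the two lines, because it is not
    the sonic point, and this line fixes the whole solution. *)
Lemma critical_solution m k r0 rho0 v0 :
  0 < m -> 0 < k -> 0 < r0 -> 0 < rho0 -> Rabs v0 <> k -> critical_G m k r0 v0 ->
  exists rho v, unique_steady_state_from m k r0 rho0 v0 0 p_infty rho v /\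
    critical_on m k 0 p_infty v /\ is_critical_curve_on m k 0 p_infty v /\
    forall r, in_itv 0 p_infty r -> sign (v r) = sign v0 /\
      (0 < (r - sonic_radius m k) * (r0 - sonic_radius m k) ->
       sign (Rabs (v r) - k) = sign (Rabs v0 - k)).
Proof.
  intros Hm Hk Hr0 Hrho0 Hside [Hv0 HG].
  assert (HG' := G_minus_Gcrit m k r0 v0 Hm Hk Hr0 Hv0).
  assert (Hc := sonic_radius_pos m k Hm Hk).
  assert (Hc0 := radial_sonic m k Hm Hk).
  assert (HM : mach k v0 <> 0).
  { intros H. apply (f_equal sign) in H.
    rewrite sign_0, mach_sign in H by assumption.
    apply (sign_neq_0 (Rabs v0 - k)); [lra|exact H]. }
  assert (Hk2 : 0 < k ^ 2 / 4) by nra.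
  assert (He : mach k v0 ^ 2 - 4 * radial m k r0 ^ 2 = 0) by nra.
  assert (Heta : exists eta, (eta = 1 \/ eta = -1) /\
    mach k v0 = 2 * eta * radial m k r0).
  { assert (H : (mach k v0 - 2 * radial m k r0) * (mach k v0 + 2 * radial m k r0) = 0)
      by nra.
    apply Rmult_integral in H. destruct H as [H|H].
    - exists 1. split; [now left|lra].
    - exists (-1). split; [now right|lra]. }
  destruct Heta as [eta [Heta Eeta]].
  assert (Heta2 : eta * eta = 1) by (destruct Heta as [-> | ->]; ring).
  assert (Hs0 : radial m k r0 <> 0).
  { intros H. apply HM. rewrite Eeta, H. ring. }
  set (W := fun r => 2 * eta * radial m k r).
  destruct (unique_steady_state_of_branch m k r0 rho0 v0 0 p_infty W) as [rho Hrho];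
    try assumption.
  - apply Rle_refl.
  - now split.
  - now symmetry.
  - intros r [Hr _]. split; [now apply smooth_critical_branch|].
    rewrite He. unfold W. nra.
  - intros a' b' w Ha' Hr0' Hw0 Hw r Hr. split.
    { split; [exact (in_itv_pos _ _ _ Ha' Hr)|exact I]. }
    destruct (critical_branch m k a' b' w r0) as [eta' [_ Hw']]; try assumption.
    { intros z Hz. destruct (Hw z Hz) as [H1 H2]. split; [exact H1|lra]. }
    assert (E : eta' = eta).
    { apply Rmult_eq_reg_r with (2 * radial m k r0); [|lra].
      rewrite (Hw' r0 Hr0') in Hw0. lra. }
    unfold W. rewrite <- E. now apply Hw'.
  - set (v := fun r => velocity_at k (sign v0) (W r)).
    assert (Hsv : forall r, sign (v r) = sign v0).
    { intros r. unfold v. rewrite sign_velocity_at by exact Hk. apply sign_sign. }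
    destruct (critical_is_curve m k v0 0 p_infty v eta) as [C1 C2]; try assumption.
    + apply Rle_refl.
    + intros r _. split; [apply Hsv|]. unfold v.
      apply mach_velocity_at; [exact Hk|now apply sign_sqr].
    + exists rho, v. split; [exact Hrho|]. split; [exact C1|]. split; [exact C2|].
      intros r [Hr _]. simpl in Hr. split; [apply Hsv|]. intros Hsame. unfold v.
      rewrite velocity_at_sonic_side by assumption.
      rewrite <- mach_sign, Eeta by assumption. unfold W.
      rewrite !sign_mult. f_equal.
      destruct (Rlt_or_le r (sonic_radius m k)) as [H|H].
      * assert (H0 : r0 < sonic_radius m k) by nra.
        rewrite !sign_eq_1; [reflexivity| |]; rewrite <- Hc0;
          now apply radial_decreasing.
      * assert (H0 : sonic_radius m k < r0) by nra.
        assert (H1 : sonic_radius m k < r) by nra.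
        rewrite !sign_eq_m1; [reflexivity| |]; rewrite <- Hc0;
          now apply radial_decreasing.
Qed.

(** Both lines pass through the sonic point, so that existence is shown along
    one of them and uniqueness is replaced by the alternative of
    [critical_branch]. *)
Lemma sonic_crossing m k r0 rho0 v0 :
  0 < m -> 0 < k -> 0 < r0 -> 0 < rho0 -> Rabs v0 = k -> critical_G m k r0 v0 ->
  (exists rho v, steady_state_from m k r0 rho0 v0 0 p_infty rho v) /\
  (forall a b rho v, steady_state_from m k r0 rho0 v0 a b rho v ->
     critical_on m k a b v /\ is_critical_curve_on m k a b v).
Proof.
  intros Hm Hk Hr0 Hrho0 Hsonic [Hv0 HG].
  assert (HG' := G_minus_Gcrit m k r0 v0 Hm Hk Hr0 Hv0).
  assert (Hk2 : 0 < k ^ 2 / 4) by nra.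
  assert (He : mach k v0 ^ 2 - 4 * radial m k r0 ^ 2 = 0) by nra.
  assert (HM : mach k v0 = 0).
  { rewrite <- (sign_abs (mach k v0)), mach_sign by assumption.
    rewrite Hsonic, Rminus_diag, sign_0. ring. }
  split.
  - set (v := fun r => velocity_at k (sign v0) (2 * 1 * radial m k r)).
    eexists. exists v. apply steady_state_of_hyperbola; try assumption.
    + apply Rle_refl.
    + now split.
    + unfold v. replace (2 * 1 * radial m k r0) with (mach k v0) by nra.
      now apply velocity_at_mach.
    + intros r [Hr _]. simpl in Hr. unfold v. split; [|split].
      * apply (smooth_velocity_at k (sign v0) (fun s => 2 * 1 * radial m k s)).
        now apply smooth_critical_branch.
      * apply velocity_at_neq0; [exact Hk|now apply sign_neq_0].
      * rewrite mach_velocity_at, He by (exact Hk || now apply sign_sqr). ring.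
  - intros a b rho v H.
    assert (Hyp := steady_state_hyperbola _ _ _ _ _ _ _ _ _ Hm Hk Hrho0 Hv0 H).
    destruct H as [[Ha [_ [Hv _]]] [Hin [_ _]]].
    assert (Hn : forall s, in_itv a b s -> v s <> 0).
    { intros s Hs H0. destruct (Hyp s Hs) as [Hsg _].
      rewrite H0, sign_0 in Hsg. now apply (sign_neq_0 v0). }
    destruct (critical_branch m k a b (fun r => mach k (v r)) r0)
      as [eta [Heta Hb]]; try assumption.
    { intros r Hr. split.
      - apply ex_derive_mach; [exact Hk|exact (Hv 1%nat r Hr)|now apply Hn].
      - destruct (Hyp r Hr) as [_ [_ E]]. lra. }
    apply (critical_is_curve m k v0 a b v eta); try assumption.
    intros r Hr. split; [now apply Hyp|now apply Hb].
Qed.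

(** * The gas at rest *)

(** The density of the gas at rest, the solution of
    [k ^ 2 * rho' = - m * rho / r ^ 2] with value [rho0] at [r0]. *)
Definition hydrostatic (m k r0 rho0 r : R) : R :=
  rho0 * exp (m / k ^ 2 * (/ r - / r0)).

Lemma smooth_hydrostatic m k r0 rho0 r :
  0 < r -> smooth (hydrostatic m k r0 rho0) r.
Proof.
  intros Hr. apply smooth_mult; [apply smooth_const|].
  apply (smooth_comp exp); [apply smooth_exp|].
  apply smooth_mult; [apply smooth_const|].
  apply smooth_plus; [apply smooth_inv; lra|apply smooth_const].
Qed.

(** The flux vanishes, so that [rho * v = 0] and the momentum equation reduces
    to the linear equation of [hydrostatic]; its solution is positive, and this
    forces [v = 0]. *)
Lemma static_solution m k r0 rho0 :
  0 < m -> 0 < k -> 0 < r0 -> 0 < rho0 ->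
  unique_steady_state_from m k r0 rho0 0 0 p_infty
    (hydrostatic m k r0 rho0) (fun _ => 0).
Proof.
  intros Hm Hk Hr0 Hrho0. split.
  - split; [split; [apply Rle_refl|split; [|split; [|split]]]|split; [|split]].
    + intros n r [Hr _]. now apply smooth_ex_derive_n, smooth_hydrostatic.
    + intros n r _. apply smooth_ex_derive_n, smooth_const.
    + intros r _. rewrite (Derive_ext _ (fun _ => 0)); [apply Derive_const|].
      intros s. ring.
    + intros r [Hr _]. simpl in Hr.
      assert (HD : Derive (fun s => s ^ 2 * (0 ^ 2 + k ^ 2) * hydrostatic m k r0 rho0 s) r
        = (2 * k ^ 2 * r - m) * hydrostatic m k r0 rho0 r).
      { apply is_derive_unique. unfold hydrostatic. auto_derive; [lra|].
        change (exp (m / (k * (k * 1)) * (/ r + - / r0)))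
          with (exp (m / k ^ 2 * (/ r - / r0))).
        set (x := exp _). field. lra. }
      rewrite HD. ring.
    + now split.
    + unfold hydrostatic. rewrite Rminus_diag, Rmult_0_r, exp_0. ring.
    + reflexivity.
  - intros a b rho v [Hss [Hin [Er Ev]]] r Hr.
    assert (Hflux : forall s, in_itv a b s -> rho s * v s = 0).
    { intros s Hs. assert (H := steady_state_flux _ _ _ _ _ _ s r0 Hss Hs Hin).
      rewrite Ev, Rmult_0_r in H.
      assert (Hsp := in_itv_pos _ _ _ (proj1 Hss) Hs).
      apply Rmult_eq_reg_l with (s ^ 2); [|nra]. lra. }
    destruct Hss as [Ha [Hrho [_ [_ Hmom]]]].
    assert (Hconst : rho r * exp (- (m / k ^ 2 * / r))
      = rho r0 * exp (- (m / k ^ 2 * / r0))).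
    { apply (constant_on_itv a b (fun s => rho s * exp (- (m / k ^ 2 * / s))));
        try assumption.
      intros z Hz. assert (Hzp := in_itv_pos _ _ _ Ha Hz).
      assert (Hd : ex_derive rho z) by exact (Hrho 1%nat z Hz).
      assert (HD : Derive (fun s => s ^ 2 * (v s ^ 2 + k ^ 2) * rho s) z
        = k ^ 2 * (2 * z * rho z + z ^ 2 * Derive rho z)).
      { apply is_derive_unique.
        apply (is_derive_ext_loc (fun s : R => k ^ 2 * (s ^ 2 * rho s))).
        - generalize (in_itv_locally _ _ _ Hz). apply filter_imp. intros s Hs.
          change (k ^ 2 * (s ^ 2 * rho s) = s ^ 2 * (v s ^ 2 + k ^ 2) * rho s).
          replace (s ^ 2 * (v s ^ 2 + k ^ 2) * rho s)
            with (s ^ 2 * v s * (rho s * v s) + k ^ 2 * (s ^ 2 * rho s)) by ring.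
          rewrite (Hflux s Hs). ring.
        - auto_derive; [tauto|]. change (Derive (fun x => rho x) z) with (Derive rho z).
          ring. }
      specialize (Hmom z Hz). rewrite HD in Hmom.
      auto_derive; [split; [exact Hd|]; split; [lra|exact I]|].
      change (Derive (fun x => rho x) z) with (Derive rho z).
      set (x := exp _).
      replace (Derive rho z) with (- m * rho z / (k ^ 2 * z ^ 2)).
      - field. lra.
      - apply Rmult_eq_reg_l with (k ^ 2 * z ^ 2).
        + field_simplify; [lra|lra].
        + apply Rmult_integral_contrapositive_currified; nra. }
    assert (Erho : rho r = hydrostatic m k r0 rho0 r).
    { apply Rmult_eq_reg_r with (exp (- (m / k ^ 2 * / r)));
        [|apply Rgt_not_eq, exp_pos].
      rewrite Hconst, Er. unfold hydrostatic. rewrite Rmult_assoc, <- exp_plus.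
      do 2 f_equal. ring. }
    assert (Hrp := in_itv_pos _ _ _ Ha Hr).
    split; [now split|split; [exact Erho|]].
    apply Rmult_eq_reg_l with (rho r).
    + rewrite (Hflux r Hr). ring.
    + rewrite Erho. apply Rgt_not_eq. apply Rmult_lt_0_compat; [exact Hrho0|apply exp_pos].
Qed.

(** * The steady states *)

(* The first part treats |v0| <> k, where existence and uniqueness hold.  The
   second part keeps the critical case for the remaining critical data, namely
   |v0| = k at the sonic radius, through which two critical curves pass. *)
Theorem theorem3p3 :
  forall (m k r0 rho0 v0 : R),
    0 < m -> 0 < k -> 0 < r0 -> 0 < rho0 ->
    (Rabs v0 <> k ->
       exists (a b : Rbar) (rho v : R -> R),
         unique_steady_state_from m k r0 rho0 v0 a b rho v /\
         sign_preserving m k r0 v0 a b v /\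
         (supercritical_G m k r0 v0 -> a = Finite 0 /\ b = p_infty) /\
         (critical_G m k r0 v0 ->
            a = Finite 0 /\ b = p_infty /\
            critical_on m k a b v /\ is_critical_curve_on m k a b v) /\
         (subcritical_G m k r0 v0 ->
            exists rS_lo rS_hi : R,
              0 < rS_lo /\ rS_lo < sonic_radius m k /\
              sonic_radius m k < rS_hi /\
              G m k rS_lo k = G m k r0 v0 /\ G m k rS_hi k = G m k r0 v0 /\
              (r0 < sonic_radius m k -> a = Finite 0 /\ b = Finite rS_lo) /\
              (sonic_radius m k < r0 -> a = Finite rS_hi /\ b = p_infty)))
    /\
    (Rabs v0 = k -> critical_G m k r0 v0 ->
       (exists rho v : R -> R,
          steady_state_from m k r0 rho0 v0 (Finite 0) p_infty rho v) /\
       (forall (a b : Rbar) (rho v : R -> R),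
          steady_state_from m k r0 rho0 v0 a b rho v ->
          critical_on m k a b v /\ is_critical_curve_on m k a b v)).
Proof.
  intros m k r0 rho0 v0 Hm Hk Hr0 Hrho0.
  split; [intros Hside|now apply sonic_crossing].
  destruct (Req_EM_T v0 0) as [->|Hv0].
  { exists (Finite 0), p_infty, (hydrostatic m k r0 rho0), (fun _ => 0).
    split; [now apply static_solution|]. split.
    - intros r _. now split.
    - split; [now split|]. split; intros [H _]; now destruct H. }
  destruct (Rtotal_order (G m k r0 v0) (Gcrit m k)) as [HG|[HG|HG]].
  - destruct (subcritical_solution m k r0 rho0 v0)
      as [a [b [rho [v [lo [hi [H1 [H2 H3]]]]]]]]; try assumption.
    exists a, b, rho, v. split; [exact H1|]. split.
    + intros r Hr. destruct (H2 r Hr). now split.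
    + split; [intros [H|H]; [now destruct Hv0|lra]|].
      split; [intros [_ H]; lra|]. intros _. now exists lo, hi.
  - destruct (critical_solution m k r0 rho0 v0) as [rho [v [H1 [H2 [H3 H4]]]]];
      try assumption; [now split|].
    exists (Finite 0), p_infty, rho, v. split; [exact H1|]. split.
    + intros r Hr. destruct (H4 r Hr) as [H5 H6]. split; [exact H5|].
      intros H. apply H6, H. now split.
    + split; [now split|]. split; [tauto|]. intros [_ H]. lra.
  - destruct (supercritical_solution m k r0 rho0 v0) as [rho [v [H1 H2]]];
      try assumption.
    exists (Finite 0), p_infty, rho, v. split; [exact H1|]. split.
    + intros r Hr. destruct (H2 r Hr). now split.
    + split; [now split|]. split; intros [_ H]; lra.
Qed.
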